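(* Let $V$ be a finite dimensional complex vector space and $A=S(V)/(S^2V)$. Then for every $p\ge1$ the component $R_{p,p+1}$ of the syzygies of $A$ is, as a $\mathrm{GL}(V)$-module, isomorphic to $\pi_{[2,1^{p-1}]}$ (irreducible, or zero if the diagram has more than $\dim V$ rows). All the other syzygies $R_{p,q}$, except for $R_{0,0}=\mathbb C$, vanish.
   Context: $S(V)$ is the symmetric algebra of $V$, graded with $V$ in degree 1, and $(S^2V)$ is the ideal generated by all quadrics. $R_{p,q}$ denotes the internal degree $q$ component of $\mathrm{Tor}_p^{S(V)}(A,\mathbb C)$, with its natural $\mathrm{GL}(V)$-action. For a partition (Young diagram) $\lambda$, $\pi_\lambda$ denotes the irreducible polynomial $\mathrm{GL}(V)$-module of highest weight $\lambda$ (with $\pi_{[1^m]}=\Lambda^mV$), which is zero if $\lambda$ has more than $\dim V$ rows; $[2,1^{p-1}]$ is the diagram with one row of length 2 followed by $p-1$ rows of length 1. *)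

(* Defs.v *)
(* The complex numbers are R[i], for an arbitrary model R : realType of the
   real numbers. *)
From HB Require Import structures.
From mathcomp Require Import all_boot all_order all_algebra.
From mathcomp Require Import boolp reals complex.
From mathcomp Require Import mpoly.

Set Implicit Arguments.
Unset Strict Implicit.
Unset Printing Implicit Defensive.

Import GRing.Theory.
Local Open Scope ring_scope.
Local Open Scope complex_scope.

(* X M : the finite sums of elements a *: m with a in X and m in M. *)
Definition smul_span (S : nzRingType) (X : S -> Prop) (M : lmodType S)
    (x : M) : Prop :=
  exists s : seq (S * M),
    (forall am, am \in s -> X am.1) /\ x = \sum_(am <- s) am.1 *: am.2.

Definition projective (S : nzRingType) (P : lmodType S) : Prop :=
  forall (M N : lmodType S) (f : {linear M -> N}) (h : {linear P -> N}),
    (forall y, exists x, f x = y) ->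
    exists h' : {linear P -> M}, forall x, f (h' x) = h x.

Section SymmetricAlgebra.
Variables (R : realType) (V : vectType R[i]).

(* S(V), identified with the polynomial ring on the basis vbasis {:V} of V. *)
Definition Sym : comNzRingType := {mpoly R[i][\dim {:V}]}.

Definition sym_inj (v : V) : Sym :=
  \sum_(k < \dim {:V}) coord (vbasis {:V}) k v *: 'X_k : {mpoly R[i][_]}.

Definition sym_scalar (c : R[i]) : Sym := c%:MP_[\dim {:V}].

Definition sym_homog (k : nat) (f : Sym) : bool :=
  (f : {mpoly R[i][\dim {:V}]}) \is k.-homog.

(* The augmentation S(V) -> C, which kills V and makes C an S(V)-module. *)
Definition sym_aug (f : Sym) : R[i] := (f : {mpoly R[i][_]})@_0%MM.

(* The ring endomorphism S(g) extending g on V; see sym_act_inj. *)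
Definition sym_act (g : 'End(V)) (f : Sym) : Sym :=
  (f : {mpoly R[i][_]}) \mPo
    [tuple (sym_inj (g (vbasis {:V})`_k) : {mpoly R[i][\dim {:V}]})
     | k < \dim {:V}].

Lemma sym_act_inj (g : 'End(V)) (v : V) :
  sym_act g (sym_inj v) = sym_inj (g v).
Proof.
rewrite /sym_act /sym_inj raddf_sum /=.
rewrite [in RHS](coord_vbasis (memvf v)) linear_sum /=.
under [RHS]eq_bigr do rewrite linear_sum scaler_suml.
rewrite exchange_big /=; apply: eq_bigr => k _.
rewrite comp_mpolyZ comp_mpolyXU (nth_map k) ?size_enum_ord // nth_ord_enum.
rewrite scaler_sumr.
by apply: eq_bigr => j _; rewrite !linearZ /= !scalerA mulrC.
Qed.

(* The ideal (S^2V). *)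
Definition quadric_ideal (f : Sym) : bool :=
  `[< smul_span (fun a => sym_homog 2 a) (f : Sym^o) >].

Fact quadric_ideal_idealr : idealr_closed quadric_ideal.
Proof.
split.
- by apply/asboolP; exists [::]; rewrite big_nil; split.
- apply/asboolP => -[s [hs]] /(congr1 sym_aug); rewrite /sym_aug raddf_sum /=.
  rewrite mcoeff1 eqxx big_seq big1 => [/eqP|am /hs /dhomog_nemf_coeff h].
    by rewrite oner_eq0.
  rewrite -[LHS]/((am.1 * am.2 : {mpoly R[i][_]})@_0%MM).
  rewrite (rmorphM (mcoeff 0%MM)) /= h; [exact: mul0r|by rewrite mf0].
- move=> a x y /asboolP[s [hs xE]] /asboolP[t [ht yE]]; apply/asboolP.
  exists ([seq (u.1, a * u.2) | u <- s] ++ t); split.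
    by move=> am; rewrite mem_cat => /orP[/mapP[u /hs ? ->]|/ht].
  rewrite big_cat big_map /= -yE; congr (_ + _).
  rewrite [x]xE mulr_sumr; apply: eq_bigr => u _.
  exact: mulrCA.
Qed.

HB.instance Definition _ :=
  isIdealr.Build Sym quadric_ideal quadric_ideal_idealr.

Definition quadric_quotient : comNzRingType := {ideal_quot (quadric_ideal : idealr Sym)}.

Definition to_quotient (f : Sym) : quadric_quotient :=
  (\pi_({ideal_quot (quadric_ideal : idealr Sym)}) f)%qT.

Lemma to_quotient_eq0 (f : Sym) : to_quotient f = 0 <-> quadric_ideal f.
Proof.
rewrite -(raddf0 (\pi_({ideal_quot (quadric_ideal : idealr Sym)}))%qT).
have E := Quotient.idealrBE (quadric_ideal : idealr Sym) f 0.
rewrite subr0 in E; rewrite /to_quotient.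
by split=> [/eqP|H]; [rewrite -E | apply/eqP; rewrite -E].
Qed.

Definition quotient_homog (q : int) (a : quadric_quotient) : Prop :=
  match q with
  | Posz k => exists2 f, sym_homog k f & a = to_quotient f
  | Negz _ => a = 0
  end.

Record is_grading (M : lmodType Sym) (D : int -> M -> Prop) : Prop := IsGrading {
  gradingB : forall q, D q 0 /\ (forall x y, D q x -> D q y -> D q (x - y));
  gradingZ : forall k q f x, sym_homog k f -> D q x -> D (q + k%:Z) (f *: x);
  grading_sum : forall x, exists (s : seq int) (c : int -> M),
    (forall q, D q (c q)) /\ x = \sum_(q <- s) c q;
  grading_direct : forall (s : seq int) (c : int -> M), uniq s ->
    (forall q, D q (c q)) -> \sum_(q <- s) c q = 0 ->
    forall q, q \in s -> c q = 0
}.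

(* A resolution ... -> P_1 -> P_0 -> A -> 0 of A = S(V)/(S^2V) by graded
   projective S(V)-modules, with maps of degree 0. Tor is computed by any of
   them. *)
Record graded_resolution := GradedResolution {
  res_mod : nat -> lmodType Sym;
  res_deg : forall p, int -> res_mod p -> Prop;
  res_diff : forall p, {linear res_mod p.+1 -> res_mod p};
  res_aug : {additive res_mod 0 -> quadric_quotient};
  res_projective : forall p, projective (res_mod p);
  res_grading : forall p, is_grading (@res_deg p);
  res_diff_deg : forall p q x, res_deg q x -> res_deg q (res_diff p x);
  res_augZ : forall f x, res_aug (f *: x) = to_quotient f * res_aug x;
  res_aug_deg : forall q x, res_deg q x -> quotient_homog q (res_aug x);
  res_aug_surj : forall a, exists x, res_aug x = a;
  res_exact0 : forall x, res_aug x = 0 <-> exists y, x = res_diff 0 y;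
  res_exact : forall p x,
    res_diff p x = 0 <-> exists y, x = res_diff p.+1 y
}.

Definition is_GL (g : 'End(V)) : bool := lker g == 0%VS.

Record GL_module := GLModule {
  GL_space :> vectType R[i];
  GL_act : 'End(V) -> 'End(GL_space);
  GL_act1 : GL_act \1%VF = \1%VF;
  GL_actM : forall g h, is_GL g -> is_GL h ->
    GL_act (g \o h)%VF = (GL_act g \o GL_act h)%VF
}.

Definition GL_trivial : GL_module.
Proof.
exists R[i]^o (fun _ => \1%VF) => [//|g h _ _].
by rewrite comp_lfun1l.
Defined.

(* The coordinates of g w are polynomials in the matrix entries of g. *)
Definition GL_polynomial (M : GL_module) : Prop :=
  forall (w : M) (k : 'I_(\dim {:M})),
  exists P : {mpoly R[i][\dim {:V} * \dim {:V}]}, forall g, is_GL g ->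
    coord (vbasis {:M}) k (GL_act M g w) =
    P.@[mxvec (\matrix_(i, j) coord (vbasis {:V}) i (g (vbasis {:V})`_j)) 0].

Definition GL_irreducible (M : GL_module) : Prop :=
  \dim {:M} != 0%N /\
  forall U : {vspace M},
    (forall g, is_GL g -> (GL_act M g @: U <= U)%VS) ->
    U = 0%VS \/ U = {:M}%VS.

(* For every basis e of V, some nonzero w is an eigenvector of the group of
   all upper triangular g, with character \prod_j t_j ^ lam_j, where
   t_0, ..., t_(n-1) is the diagonal of g. *)
Definition GL_highest_weight (M : GL_module) (lam : seq nat) : Prop :=
  forall e : (\dim {:V}).-tuple V, basis_of {:V} e ->
  exists2 w : M, w != 0 &
    forall g (t : 'I_(\dim {:V}) -> R[i]), is_GL g ->
    (forall j : 'I_(\dim {:V}),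
       g e`_j - t j *: e`_j \in <<take j e>>%VS) ->
    GL_act M g w = (\prod_j t j ^+ nth 0%N lam j) *: w.

(* M is the module pi_lam, for a partition lam listed without zeros. *)
Definition is_pi (lam : seq nat) (M : GL_module) : Prop :=
  if (size lam <= \dim {:V})%N then
    [/\ GL_polynomial M, GL_irreducible M & GL_highest_weight M lam]
  else \dim {:M} = 0%N.

Section Tor.
Variable F : graded_resolution.

(* Since C = S(V)/m, where m is the kernel of sym_aug, P (x)_S(V) C = P / m P.
   Hence R_{p,q}, the degree q part of H_p(P (x) C), is the quotient of
   tor_cycle p q by tor_boundary p q, both inside the degree q part of P_p. *)
Definition in_mP (p : nat) (x : res_mod F p) : Prop :=
  smul_span (fun f => sym_aug f = 0) x.

Definition res_cycle (p : nat) : res_mod F p -> Prop :=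
  if p is p'.+1 then fun x => in_mP (res_diff F p' x) else fun=> True.

Definition tor_cycle (p : nat) (q : int) (x : res_mod F p) : Prop :=
  res_deg q x /\ res_cycle x.

Definition tor_boundary (p : nat) (q : int) (x : res_mod F p) : Prop :=
  res_deg q x /\ exists y, in_mP (x - res_diff F p y).

Definition tor_zero (p : nat) (q : int) : Prop :=
  forall x : res_mod F p, tor_cycle q x -> tor_boundary q x.

(* G is a degree 0 chain map, semilinear along S(g), over the automorphism of
   A induced by g. Such a G exists for every g and is unique up to homotopy;
   the map it induces on R_{p,q} is the natural action of g. *)
Record is_lift (g : 'End(V)) (G : forall p, res_mod F p -> res_mod F p) : Prop :=
IsLift {
  liftD : forall p x y, G p (x + y) = G p x + G p y;
  liftZ : forall p f x, G p (f *: x) = sym_act g f *: G p x;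
  lift_deg : forall p q x, res_deg q x -> res_deg q (G p x);
  lift_diff : forall p x, G p (res_diff F p x) = res_diff F p (G p.+1 x);
  lift_aug : forall x f, res_aug F x = to_quotient f ->
    res_aug F (G 0%N x) = to_quotient (sym_act g f)
}.

(* phi induces an isomorphism of GL(V)-modules from R_{p,q} onto M. *)
Definition tor_iso (p : nat) (q : int) (M : GL_module) : Prop :=
  exists phi : res_mod F p -> M,
  [/\ forall c x y, tor_cycle q x -> tor_cycle q y ->
        phi (sym_scalar c *: x + y) = c *: phi x + phi y,
      forall w, exists2 x, tor_cycle q x & phi x = w,
      forall x, tor_cycle q x -> (phi x = 0 <-> tor_boundary q x) &
      forall g G, is_GL g -> is_lift g G ->
        forall x, tor_cycle q x -> phi (G p x) = GL_act M g (phi x)].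

End Tor.
End SymmetricAlgebra.

(* Main.v *)
Require Import Defs.
From mathcomp Require Import all_boot all_order all_algebra.
From mathcomp Require Import reals complex.
From HB Require Import structures.
From mathcomp Require Import boolp mpoly ring.
From mathcomp Require finmap monalg.

(** Let S = S(V), n = dim V, and let m be the augmentation ideal, so that
A = S/m^2 = C + V.  Tor(A, C) can be computed from either side.  On the
Koszul side it is the homology of A (x) /\V, where only two degrees occur:
C (x) /\^p V in degree p and V (x) /\^p V in degree p + 1, with the
comultiplication /\^p V -> V (x) /\^(p-1) V between them.  This map is
injective for p >= 1, so R_{p,q} vanishes unless q = p + 1 (or p = q = 0), and
R_{p,p+1} is the cokernel of /\^(p+1) V -> V (x) /\^p V, which is
pi_[2,1^(p-1)].

An arbitrary graded projective resolution F is compared with the Koszul side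
by zigzags in the double complex F (x) /\V: a cycle x in F_p is followed by
elements x_j in F_(p-j) (x) /\^j V such that the image of x_j under the
differential of F is the image of x_(j+1) under the Koszul differential; the
augmentation of x_p lies in A (x) /\^p V.  Zigzags exist and are unique up to
boundaries because the Koszul complex is exact with coefficients in a
projective module [koszul_exact_projective] and because F is exact
([zigzag_exists], [zigzag_boundary], [boundary_zigzag], [zigzag_surj]).  Keeping
the zigzag as a relation has the advantage that a semilinear lift G of g maps
zigzags to zigzags [zigzag_lift], so that the induced map on homology is
equivariant with no homotopy to construct.

The cokernel of /\^(p+1) V -> V (x) /\^p V is realized as the image of
V (x) /\^p V under symmetrization of the first two arguments, whose kernel is
exactly /\^(p+1) V [hook_tensor].  An invariant subspace U of it is stable
under all matrices, not only the invertible ones, by density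
[packed_act_stable].  If U is nonzero, substituting suitable linear forms
gives an element with a nonzero coefficient of weight (2,1,...,1), and the
coefficient of T^2 under e_0 -> T e_0 is a multiple of the highest weight
vector [stable_highest_weight].  Conversely, the highest weight vector yields
all x.(x /\ y), hence by polarization all of the module
[stable_generation]. *)

Set Implicit Arguments.
Unset Strict Implicit.
Unset Printing Implicit Defensive.
Import GRing.Theory Num.Theory.
Local Open Scope ring_scope.
Local Open Scope complex_scope.

(** * Alternating tensors *)

Lemma perm_move (T : eqType) (a : T) s t :
  perm_eq (s ++ a :: t) (a :: s ++ t).
Proof. by rewrite -[a :: t]cat1s perm_catCA. Qed.

Lemma perm_swap (T : eqType) (a b : T) s t :
  perm_eq (s ++ a :: b :: t) (s ++ b :: a :: t).
Proof. by rewrite perm_cat2l -[a :: b :: t]/([:: a] ++ [:: b] ++ t) perm_catCA. Qed.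

Section Alternating.
Variable n : nat.
Local Notation I := 'I_n.

(** Tensors of all orders with values in M are functions on words in the indices
    of a basis; the value at a word is the coordinate of the tensor. *)
Definition alternating (M : zmodType) (x : seq I -> M) : Prop :=
  forall s a b t, x (s ++ a :: b :: t) = - x (s ++ b :: a :: t).

Definition alt_tensor (M : zmodType) (j : nat) (x : seq I -> M) : Prop :=
  alternating x /\ forall t, size t != j -> x t = 0.

Section Values.
Variable M : zmodType.
Implicit Types x y : seq I -> M.

Lemma alternating_tail x a : alternating x -> alternating (fun t => x (a :: t)).
Proof. by move=> hx s; apply: (hx (a :: s)). Qed.

Lemma alternating_swap x : alternating x ->
  forall a b t, x (a :: b :: t) = - x (b :: a :: t).
Proof. by move=> hx; apply: (hx [::]). Qed.

Lemma alternating_move x : alternating x ->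
  forall s a t, x (s ++ a :: t) = 0 <-> x (a :: s ++ t) = 0.
Proof.
move=> hx s; elim/last_ind: s => [|s b IH] a t //=.
rewrite -cats1 -!catA /= hx; split=> [/eqP|/(IH a (b :: t)) ->]; last exact: oppr0.
by rewrite oppr_eq0 => /eqP /(IH a (b :: t)).
Qed.

(** A permutation of the arguments only changes the sign; vanishing is all that
    is used below, and avoids keeping track of that sign. *)
Lemma alternating_perm0 x s t :
  alternating x -> perm_eq s t -> x s = 0 -> x t = 0.
Proof.
elim: s t x => [|a s IH] t x hx.
  by rewrite perm_sym => /perm_nilP ->.
move=> pst; have at_ : a \in t by rewrite -(perm_mem pst) mem_head.
move: pst; case/splitPr: at_ => t1 t2.
rewrite (permPr (perm_move _ _ _)) perm_cons => pst xs.
apply/(alternating_move hx).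
exact: (IH _ (fun r => x (a :: r)) (alternating_tail a hx) pst xs).
Qed.

(** The absence of 2-torsion turns antisymmetric tensors into alternating ones. *)
Definition two_free := forall m : M, m + m = 0 -> m = 0.

Lemma alternating_nuniq x t : two_free -> alternating x -> ~~ uniq t -> x t = 0.
Proof.
move=> M2; elim: t x => //= a t IH x hx.
rewrite negb_and negbK => /orP[|nu]; last exact: IH (alternating_tail a hx) nu.
case/splitPr => t1 t2 {IH}.
have Hp : perm_eq (a :: a :: t1 ++ t2) (a :: t1 ++ a :: t2).
  by rewrite perm_cons perm_sym perm_move.
apply: (alternating_perm0 hx Hp); apply: M2.
by rewrite {1}(alternating_swap hx) addNr.
Qed.

Lemma alternatingD x y : alternating x -> alternating y ->
  alternating (fun t => x t + y t).
Proof. by move=> hx hy s a b t; rewrite hx hy opprD. Qed.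

Lemma alternating_sum (J : finType) (x : J -> seq I -> M) :
  (forall i, alternating (x i)) -> alternating (fun t => \sum_i x i t).
Proof.
by move=> hx s a b t; rewrite -sumrN; apply: eq_bigr => i _; apply: hx.
Qed.

Lemma alt_tensorD j x y : alt_tensor j x -> alt_tensor j y ->
  alt_tensor j (fun t => x t + y t).
Proof.
move=> [hx x0] [hy y0]; split; first exact: alternatingD.
by move=> t tj; rewrite x0 // y0 // addr0.
Qed.

Lemma alternating_additive (N : zmodType) (f : {additive M -> N}) x :
  alternating x -> alternating (fun t => f (x t)).
Proof. by move=> hx s a b t; rewrite hx raddfN. Qed.

Lemma alt_tensor_additive (N : zmodType) (f : {additive M -> N}) j x :
  alt_tensor j x -> alt_tensor j (fun t => f (x t)).
Proof.
move=> [hx x0]; split; first exact: alternating_additive.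
by move=> t tj; rewrite x0 // raddf0.
Qed.

Definition scalar_tensor (m : M) (t : seq I) : M := if t is [::] then m else 0.

Definition vector_tensor (v : I -> M) (t : seq I) : M :=
  if t is [:: a] then v a else 0.

Lemma scalar_tensor_alt m : alt_tensor 0 (scalar_tensor m).
Proof. by split=> [[|c [|d s]] a b t|[|a t]] //=; rewrite oppr0. Qed.

Lemma vector_tensor_alt v : alt_tensor 1 (vector_tensor v).
Proof. by split=> [[|c [|d s]] a b t|[|a [|b t]]] //=; rewrite oppr0. Qed.

Lemma alternating_trunc j x : alternating x ->
  alt_tensor j (fun t => if size t == j then x t else 0).
Proof.
move=> hx; split=> [s a b t|t /negbTE -> //].
by rewrite !size_cat /= hx; case: ifP; rewrite ?oppr0.
Qed.

End Values.

Definition pair_sign (a b : I) : int := sgz (b%:Z - a%:Z).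

(** The product of [pair_sign] over all pairs of positions: the sign of the
    permutation that sorts t if t has no repetition, and 0 otherwise. *)
Fixpoint sort_sign (t : seq I) : int :=
  if t is a :: t' then (\prod_(b <- t') pair_sign a b) * sort_sign t' else 1.

Lemma sort_sign_alternating : alternating sort_sign.
Proof.
elim=> [|c s IH] a b t /=.
  rewrite !big_cons -mulNr.
  have -> : pair_sign a b = - pair_sign b a.
    by rewrite /pair_sign -sgzN opprB.
  rewrite !mulNr !mulrA; congr (- (_ * _)); rewrite -!mulrA; congr (_ * _).
  exact: mulrC.
rewrite IH mulrN; congr (- (_ * _)).
by apply: perm_big; rewrite perm_swap.
Qed.

Definition ord_le (a b : I) := (a <= b)%N.

Definition sort_ord (t : seq I) := sort ord_le t.

Lemma sort_sign_sorted t : uniq t -> sorted ord_le t -> sort_sign t = 1.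
Proof.
elim: t => //= a t IH /andP[at_ ut] pt.
have tr : transitive ord_le by move=> b c d; apply: leq_trans.
rewrite IH ?(path_sorted pt) // mulr1 big_seq big1 // => b bt.
have ab : (a < b)%N.
  rewrite ltn_neqAle; apply/andP; split.
    by apply: contraNneq at_ => /val_inj ->.
  by move/allP: (order_path_min tr pt) => /(_ b bt).
by rewrite /pair_sign gtr0_sgz // subr_gt0.
Qed.

Lemma sort_ord_perm s t : perm_eq s t -> sort_ord s = sort_ord t.
Proof.
have tt : total ord_le by move=> b c; apply: leq_total.
have tr : transitive ord_le by move=> b c d; apply: leq_trans.
have an : antisymmetric ord_le by move=> b c /anti_leq /val_inj.
by move/(perm_sortP tt tr an).
Qed.

(** The difference of both sides is alternating and vanishes at sorted words. *)
Lemma alternating_sort (M : zmodType) (x : seq I -> M) t : two_free M ->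
  alternating x -> x t = x (sort_ord t) *~ sort_sign t.
Proof.
move=> M2 hx.
have [ut|nu] := boolP (uniq t); last first.
  rewrite alternating_nuniq // [x (sort_ord _)]alternating_nuniq ?mul0rz //.
  by rewrite sort_uniq.
apply/eqP; rewrite -subr_eq0; apply/eqP.
pose y s := x s - x (sort_ord s) *~ sort_sign s.
have hy : alternating y.
  move=> s a b r; rewrite /y hx sort_sign_alternating.
  rewrite (_ : sort_ord (s ++ a :: b :: r) = sort_ord (s ++ b :: a :: r)).
    by rewrite mulrNz opprD.
  by apply: sort_ord_perm; rewrite perm_swap.
apply: (@alternating_perm0 _ y (sort_ord t)) => //; first by rewrite perm_sort.
rewrite /y (sort_sign_sorted (t := sort_ord t)) ?sort_uniq //; last first.
  by apply: sort_sorted => b c; apply: leq_total.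
rewrite mulr1z (_ : sort_ord (sort_ord t) = sort_ord t) ?subrr //.
by apply: sort_ord_perm; rewrite perm_sort.
Qed.

(** /\^j V is free, so tensoring with it preserves surjections: a preimage is
    chosen at sorted words and extended to the others by the sign. *)
Lemma alt_tensor_lift (M N : zmodType) (f : {additive M -> N}) j (x : seq I -> N) :
  two_free N -> alt_tensor j x -> (forall t, exists z, f z = x t) ->
  exists2 z, alt_tensor j z & forall t, f (z t) = x t.
Proof.
move=> N2 [hx x0] fx.
have [z0 hz0] := boolp.choice fx.
pose z t := if size t == j then z0 (sort_ord t) *~ sort_sign t else 0.
exists z.
  apply: (@alternating_trunc _ j (fun t => z0 (sort_ord t) *~ sort_sign t)).
  move=> s a b r; rewrite sort_sign_alternating mulrNz.
  congr (- (z0 _ *~ _)).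
  by apply: sort_ord_perm; rewrite perm_swap.
move=> t; rewrite /z; case: eqP => [_|/eqP tj]; last by rewrite raddf0 x0.
by rewrite raddfMz hz0 -alternating_sort.
Qed.

(** At the word k_0 ... k_j this is the alternating sum over i of D k_i applied
    to the value of x at the word without k_i.  Multiplication by scalars
    v k gives the exterior product by the vector v, and the partial derivatives
    give the de Rham differential. *)
Fixpoint ext (M N : zmodType) (D : I -> M -> N) (x : seq I -> M) (t : seq I) : N :=
  if t is k :: t' then D k (x t') - ext D (fun s => x (k :: s)) t' else 0.

Lemma eq_ext (M N : zmodType) (D : I -> M -> N) (x y : seq I -> M) t :
  (forall s, (size s).+1 = size t -> x s = y s) -> ext D x t = ext D y t.
Proof.
elim: t x y => //= k t IH x y xy; rewrite xy //; congr (_ - _).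
by apply: IH => s st; apply: xy; rewrite -st.
Qed.

Section Ext.
Variables (M N : zmodType) (D : I -> {additive M -> N}).
Local Notation ext := (ext D).

Lemma extD (x y : seq I -> M) t : ext (fun s => x s + y s) t = ext x t + ext y t.
Proof.
elim: t x y => [|k t IH] x y /=; first by rewrite addr0.
by rewrite IH raddfD opprD addrACA.
Qed.

Lemma extN (x : seq I -> M) t : ext (fun s => - x s) t = - ext x t.
Proof.
elim: t x => [|k t IH] x /=; first by rewrite oppr0.
by rewrite IH raddfN opprD.
Qed.

Lemma ext0 t : ext (fun=> 0) t = 0.
Proof. by elim: t => //= k t ->; rewrite raddf0 subrr. Qed.

Lemma ext_sum (J : finType) (x : J -> seq I -> M) t :
  ext (fun s => \sum_i x i s) t = \sum_i ext (x i) t.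
Proof.
elim: t x => [|k t IH] x /=; first by rewrite big1.
by rewrite IH raddf_sum sumrB.
Qed.

Lemma ext_alternating (x : seq I -> M) : alternating x -> alternating (ext x).
Proof.
move=> hx s; elim: s x hx => [|c s IH] x hx a b t /=.
  rewrite (@eq_ext _ _ _ (fun s => x (a :: b :: s)) (fun s => - x (b :: a :: s))) //.
    by rewrite extN opprK opprB opprD addrA addrAC.
  by move=> r _; apply: alternating_swap.
by rewrite hx raddfN IH ?opprD //; apply: alternating_tail.
Qed.

Lemma ext_alt_tensor j (x : seq I -> M) :
  alt_tensor j x -> alt_tensor j.+1 (ext x).
Proof.
move=> [hx x0]; split; first exact: ext_alternating.
move=> t; elim: t j x {hx} x0 => //= k t IH j x x0 tj.
have tj' : size t != j by rewrite -eqSS.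
rewrite x0 // raddf0.
case: j => [|j] in x0 tj tj' *.
  by rewrite (@eq_ext _ _ _ _ (fun=> 0)) ?ext0 ?subrr // => s _; apply: x0.
by rewrite (IH j) ?subrr // => s sj; apply: x0.
Qed.

End Ext.
End Alternating.

(** * The Koszul complex *)

Section Koszul.
Variables (n : nat) (S : comNzRingType) (X : 'I_n -> S).
Local Notation I := 'I_n.

(** The contraction of a tensor with the vector of the X k: on alternating
    tensors this is the Koszul differential. *)
Definition koszul (M : lmodType S) (x : seq I -> M) (t : seq I) : M :=
  \sum_k X k *: x (k :: t).

Section Module.
Variable M : lmodType S.
Implicit Types x y : seq I -> M.

Lemma eq_koszul x y t : (forall s, x s = y s) -> koszul x t = koszul y t.
Proof. by move=> xy; apply: eq_bigr => k _; rewrite xy. Qed.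

Lemma koszulD x y t : koszul (fun s => x s + y s) t = koszul x t + koszul y t.
Proof. by rewrite -big_split; apply: eq_bigr => k _; rewrite scalerDr. Qed.

Lemma koszulB x y t : koszul (fun s => x s - y s) t = koszul x t - koszul y t.
Proof. by rewrite -sumrB; apply: eq_bigr => k _; rewrite scalerBr. Qed.

Lemma koszulZ c x t : koszul (fun s => c *: x s) t = c *: koszul x t.
Proof.
by rewrite scaler_sumr; apply: eq_bigr => k _; rewrite !scalerA mulrC.
Qed.

Lemma koszul_alternating x : alternating x -> alternating (koszul x).
Proof.
move=> hx s a b t; rewrite -sumrN; apply: eq_bigr => k _.
by rewrite -scalerN -(hx (k :: s)).
Qed.

Lemma koszul_alt_tensor j x : alt_tensor j.+1 x -> alt_tensor j (koszul x).
Proof.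
move=> [hx x0]; split; first exact: koszul_alternating.
by move=> t tj; rewrite /koszul big1 // => k _; rewrite x0 ?scaler0.
Qed.

(** Exchanging the two summation indices changes the sign of the double sum. *)
Lemma koszul_koszul x t :
  two_free M -> alternating x -> koszul (koszul x) t = 0.
Proof.
move=> M2 hx; apply: M2; rewrite /koszul.
under eq_bigr do rewrite scaler_sumr.
rewrite [X in _ + X]exchange_big -big_split big1 // => k _.
rewrite -big_split big1 // => l _ /=.
by rewrite alternating_swap // !scalerN !scalerA mulrC addNr.
Qed.

Lemma koszul_linear (N : lmodType S) (f : {linear M -> N}) x t :
  f (koszul x t) = koszul (fun s => f (x s)) t.
Proof. by rewrite linear_sum; apply: eq_bigr => k _; rewrite linearZ. Qed.

End Module.

(** Exactness in exterior degrees at least 1. *)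
Definition koszul_exact (M : lmodType S) := forall j (x : seq I -> M),
  alt_tensor j.+1 x -> (forall t, koszul x t = 0) ->
  exists2 u, alt_tensor j.+2 u & forall t, x t = koszul u t.

Import finmap monalg.

(** The canonical surjection onto M from the free module on the set M. *)
Definition free_lift (M : lmodType S) (g : malg M S) : M :=
  \sum_(k <- msupp g) mcoeff k g *: k.

Lemma free_liftE (M : lmodType S) (g : malg M S) (d : {fset M}) :
  fsubset (msupp g) d -> free_lift g = \sum_(k <- d) mcoeff k g *: k.
Proof.
move=> gd; rewrite /free_lift (big_fset_incl _ gd) //= => k _ kg.
by rewrite mcoeff_outdom ?scale0r.
Qed.

Fact free_lift_linear (M : lmodType S) : linear (@free_lift M).
Proof.
move=> c g h; pose d := (msupp g `|` msupp h)%fset.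
rewrite (free_liftE (g := g) (d := d)) ?fsubsetUl //.
rewrite (free_liftE (g := h) (d := d)) ?fsubsetUr //.
rewrite (free_liftE (d := d)).
  rewrite scaler_sumr -big_split; apply: eq_bigr => k _ /=.
  by rewrite mcoeffD mcoeffZ scalerDl scalerA.
apply: (fsubset_trans (msuppD_le _ _)).
by apply: fsetUSS => //; apply: msuppZ_le.
Qed.

HB.instance Definition _ (M : lmodType S) :=
  GRing.isLinear.Build S (malg M S) M *:%R (@free_lift M) (@free_lift_linear M).

(** A section of [free_lift] is a dual basis of P: each y in P is the sum
    over k in P of its k-th coordinate times k.  The coordinates of a cycle are cycles over S; only
    finitely many are nonzero, and their primitives are reassembled. *)
Lemma koszul_exact_projective (P : lmodType S) :
  koszul_exact S^o -> projective P -> koszul_exact P.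
Proof.
move=> exS projP j x hx dx.
have [s hs] : exists s : {linear P -> malg P S}, forall y, free_lift (s y) = y.
  apply: (projP _ _ (@free_lift P) idfun) => y.
  exists (mkmalgU y 1); rewrite /= (free_liftE msuppU_le) big_seq_fset1.
  by rewrite mcoeffUU scale1r.
have exk k : exists2 u : seq I -> S^o, alt_tensor j.+2 u &
    forall t, mcoeff k (s (x t)) = koszul u t.
  apply: (exS j (fun t => mcoeff k (s (x t)) : S^o)).
    exact: (alt_tensor_additive (mcoeff k) (alt_tensor_additive s hx)).
  move=> t; have := congr1 (fun y => mcoeff k (s y)) (dx t).
  rewrite !raddf0 => <-; rewrite linear_sum raddf_sum; apply: eq_bigr => l _.
  by rewrite linearZ /= mcoeffZ.
have /boolp.choice[u hu] k : exists u : seq I -> S^o, alt_tensor j.+2 u /\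
    forall t, mcoeff k (s (x t)) = koszul u t.
  by have [u] := exk k; exists u.
(* x has finitely many nonzero values, so finitely many coordinates occur *)
pose d := \big[@fsetU _/fset0]_(r : (j.+1).-tuple I) msupp (s (x r)).
have sub_d t : fsubset (msupp (s (x t))) d.
  have [tj|tj] := boolP (size t == j.+1).
    by rewrite /d (bigD1 (Tuple tj)) //= fsubsetUl.
  by case: hx => _ ->; rewrite // raddf0 msupp0 fsub0set.
exists (fun t => \sum_(k <- d) u k t *: k).
  split=> [r a b t|t tj].
    by rewrite -sumrN; apply: eq_bigr => k _; case: (hu k) => -[-> _] _; rewrite scaleNr.
  by rewrite big1 // => k _; case: (hu k) => -[_ ->] // _; rewrite scale0r.
move=> t; rewrite -[LHS]hs /= (free_liftE (sub_d t)) /koszul.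
under [RHS]eq_bigr do rewrite scaler_sumr.
rewrite exchange_big; apply: eq_bigr => k _ /=.
case: (hu k) => _ ->; rewrite scaler_suml; apply: eq_bigr => l _.
by rewrite scalerA.
Qed.

End Koszul.

Section PolynomialKoszul.
Variables (n : nat) (C : numFieldType).
Local Notation S := {mpoly C[n]}.

(** The inverse of E + c, where E is the Euler operator, which multiplies a
    monomial by its degree. *)
Definition euler_inv (c : nat) (p : S) : S :=
  \sum_(m <- msupp p) (p@_m / (mdeg m + c)%:R) *: 'X_[m].

Lemma mcoeff_euler_inv c p m : (euler_inv c p)@_m = p@_m / (mdeg m + c)%:R.
Proof.
rewrite /euler_inv raddf_sum /=.
under eq_bigr do rewrite mcoeffZ mcoeffX.
have [mp|mp] := boolP (m \in msupp p).
  rewrite (bigD1_seq m) //= eqxx mulr1 big1 ?addr0 // => k /negbTE ->.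
  by rewrite mulr0.
rewrite (memN_msupp_eq0 mp) mul0r big_seq big1 // => k kp.
by case: eqP => [km|]; rewrite ?mulr0 //; rewrite km (negbTE mp) in kp.
Qed.

Fact euler_inv_additive c : additive (euler_inv c).
Proof.
by move=> p q; apply/mpolyP => m; rewrite mcoeffB !mcoeff_euler_inv mcoeffB mulrBl.
Qed.

HB.instance Definition _ c :=
  GRing.isAdditive.Build S S (euler_inv c) (euler_inv_additive c).

Lemma euler_invMX c p k : 'X_k * euler_inv c.+1 p = euler_inv c ('X_k * p).
Proof.
rewrite ![ 'X_k * _]mulrC; apply/mpolyP => m.
have [km|km] := boolP (U_(k) <= m)%MM.
  rewrite -(submK km) addmC mcoeff_euler_inv !mcoeffMX mcoeff_euler_inv.
  by rewrite mdegD mdeg1 add1n addSnnS.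
rewrite mcoeff_euler_inv !(memN_msupp_eq0 (m := m)) ?mul0r //.
  rewrite (perm_mem (msuppMX _ _)); apply: contra km => /mapP[m' _ ->].
  exact: lem_addr.
rewrite (perm_mem (msuppMX _ _)); apply: contra km => /mapP[m' _ ->].
exact: lem_addr.
Qed.

Lemma mderiv_mpolyX_sum m :
  \sum_k 'X_k * ('X_[m] : S)^`M(k) = (mdeg m)%:R *: 'X_[m].
Proof.
rewrite mdegE natr_sum scaler_suml; apply: eq_bigr => k _.
rewrite mderivX -scalerAr -mpolyXD.
have [->|mk] := eqVneq (m k) 0%N; first by rewrite !scale0r.
by rewrite addmC submK // lep1mP.
Qed.

Lemma euler_invK c p : (0 < c)%N || (p@_0%MM == 0) ->
  \sum_k 'X_k * (euler_inv c p)^`M(k) + euler_inv c p *+ c = p.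
Proof.
move=> cp; rewrite [RHS]mpolyE {1 2}/euler_inv.
under eq_bigr do rewrite raddf_sum mulr_sumr.
rewrite exchange_big -sumrMnl -big_split big_seq [RHS]big_seq.
apply: eq_bigr => m mp /=.
under eq_bigr do rewrite mderivZ -scalerAr.
rewrite -scaler_sumr mderiv_mpolyX_sum scalerA -scaler_nat scalerA -scalerDl.
rewrite [c%:R * _]mulrC -mulrDr -natrD divfK // pnatr_eq0 addn_eq0 mdeg_eq0.
apply/negP => /andP[/eqP m0 /eqP c0]; move: cp; rewrite c0 /= mcoeff_eq0.
by rewrite -m0 mp.
Qed.

Lemma augmentation_sum p : p@_0%MM = 0 -> exists q : 'I_n -> S, p = \sum_k 'X_k * q k.
Proof.
move=> p0; exists (fun k => (euler_inv 0 p)^`M(k)).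
by rewrite -[LHS](@euler_invK 0) ?p0 ?eqxx // mulr0n addr0.
Qed.

Let D (k : 'I_n) : {additive S -> S} := mderiv k.

(** Cartan's formula for the Lie derivative along the Euler field: E acts on
    the coefficients, and the j differentials of a j-form contribute j. *)
Lemma koszul_ext_mderiv (w : seq 'I_n -> S) t : alternating w ->
  koszul (fun k => 'X_k) (ext D w : seq 'I_n -> S^o) t
    + ext D (koszul (fun k => 'X_k) (w : seq 'I_n -> S^o)) t
  = \sum_k 'X_k * (w t)^`M(k) + w t *+ size t.
Proof.
elim: t w => [|a t IH] w hw /=.
  by rewrite addr0 mulr0n addr0; apply: eq_bigr => k _; rewrite /= subr0.
pose wa s := w (a :: s); have IHa := IH wa (alternating_tail a hw).
have swapE k s : w (k :: a :: s) = - wa (k :: s) by apply: alternating_swap.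
have E1 : koszul (fun k => 'X_k) (ext D w : seq 'I_n -> S^o) (a :: t) =
    koszul (fun k => 'X_k) (ext D wa : seq 'I_n -> S^o) t
      - \sum_k 'X_k * (w (k :: t))^`M(a).
  rewrite /koszul -sumrB; apply: eq_bigr => k _ /=.
  rewrite (@eq_ext _ _ _ _ (fun s => w (k :: a :: s)) (fun s => - wa (k :: s))) //.
  by rewrite extN opprK opprD addrA addrAC scalerBr.
have E2 : D a (koszul (fun k => 'X_k) (w : seq 'I_n -> S^o) t) =
    w (a :: t) + \sum_k 'X_k * (w (k :: t))^`M(a).
  rewrite /koszul raddf_sum /=.
  under eq_bigr do rewrite /GRing.scale /= mderivM.
  rewrite big_split /=; congr (_ + _).
  rewrite (bigD1 a) //= mderivX mnm1E eqxx scale1r.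
  rewrite big1 => [|k ka]; last by rewrite mderivX mnm1E (negbTE ka) scale0r mul0r.
  rewrite addr0 (_ : (U_(a) - U_(a))%MM = 0%MM) ?mpolyX0 ?mul1r //.
  by apply/mnmP => i; rewrite mnmBE subnn mnmE.
have E3 : ext D (fun s => koszul (fun k => 'X_k) (w : seq 'I_n -> S^o) (a :: s)) t =
    - ext D (koszul (fun k => 'X_k) (wa : seq 'I_n -> S^o)) t.
  rewrite -extN; apply: eq_ext => s _; rewrite /koszul -sumrN.
  by apply: eq_bigr => k _; rewrite swapE scalerN.
rewrite E1 E2 E3 opprK mulrSr [RHS]addrA.
transitivity (\sum_k 'X_k * (wa t)^`M(k) + wa t *+ size t + wa t); last by [].
rewrite -IHa -/(wa t).
set A := koszul _ _ _; set B := \sum_k _; set E := ext _ _ _.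
rewrite -!addrA; congr (_ + _).
by rewrite addrCA addKr addrC.
Qed.

(** The operator E + j is invertible on j-forms, so Cartan's formula makes the
    de Rham differential a contracting homotopy. *)
Lemma koszul_exact_mpoly :
  @koszul_exact n S (fun k => 'X_k) (S^o : lmodType S).
Proof.
move=> j x hx dx.
pose y t := euler_inv j.+1 (x t).
have hy : alt_tensor j.+1 y by exact: (alt_tensor_additive (euler_inv j.+1) hx).
exists (ext D y); first exact: (ext_alt_tensor D hy).
move=> t; have := koszul_ext_mderiv t hy.1.
rewrite (@eq_ext _ _ _ _ _ (fun=> 0)) ?(ext0 D) ?addr0 => [->|s _]; last first.
  transitivity (euler_inv j (koszul (fun k => 'X_k) (x : seq 'I_n -> S^o) s)).
    by rewrite raddf_sum; apply: eq_bigr => k _; apply: euler_invMX.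
  by rewrite dx raddf0.
have [->|tj] := eqVneq (size t) j.+1; first by rewrite euler_invK.
rewrite hx.2 // hy.2 // mul0rn addr0 big1 // => k _.
by rewrite mderiv0 mulr0.
Qed.

End PolynomialKoszul.

(** * Linear substitutions and exterior products of tensors *)

Section TensorPower.
Variables (n : nat) (K : comNzRingType).
Local Notation I := 'I_n.

(** The tensor power of the matrix g, acting on coordinates. *)
Fixpoint tensor_act (M : lmodType K) (g : I -> I -> K) (w : seq I -> M) (s : seq I) : M :=
  if s is a :: s' then \sum_k g a k *: tensor_act g (fun r => w (k :: r)) s' else w [::].

Section Basics.
Variables (M : lmodType K) (g : I -> I -> K).
Implicit Types (w : seq I -> M) (s : seq I).

Lemma eq_tensor_act w w' s : (forall r, size r = size s -> w r = w' r) ->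
  tensor_act g w s = tensor_act g w' s.
Proof.
elim: s w w' => [|a s IH] w w' ww' /=; first exact: ww'.
by apply: eq_bigr => k _; congr (_ *: _); apply: IH => r rs; apply: ww'; rewrite /= rs.
Qed.

Lemma tensor_act0 s : tensor_act g (fun=> 0 : M) s = 0.
Proof. by elim: s => //= a s IH; rewrite big1 // => k _; rewrite IH scaler0. Qed.

Lemma tensor_act_size0 w s :
  (forall r, size r = size s -> w r = 0) -> tensor_act g w s = 0.
Proof. by move=> w0; rewrite (eq_tensor_act w0) tensor_act0. Qed.

Lemma tensor_actP c w w' s :
  tensor_act g (fun r => c *: w r + w' r) s = c *: tensor_act g w s + tensor_act g w' s.
Proof.
elim: s w w' => //= a s IH w w'; rewrite scaler_sumr -big_split /=.
by apply: eq_bigr => k _; rewrite IH scalerDr !scalerA mulrC.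
Qed.

Lemma tensor_actD w w' s :
  tensor_act g (fun r => w r + w' r) s = tensor_act g w s + tensor_act g w' s.
Proof.
rewrite -[tensor_act g w s]scale1r -tensor_actP.
by apply: eq_tensor_act => r _; rewrite scale1r.
Qed.

Lemma tensor_actZ c w s : tensor_act g (fun r => c *: w r) s = c *: tensor_act g w s.
Proof.
rewrite (@eq_tensor_act _ (fun r => c *: w r + 0)) ?tensor_actP ?tensor_act0 ?addr0 // => r _.
by rewrite addr0.
Qed.

Lemma tensor_actN w s : tensor_act g (fun r => - w r) s = - tensor_act g w s.
Proof.
by rewrite -scaleN1r -tensor_actZ; apply: eq_tensor_act => r _; rewrite scaleN1r.
Qed.

Lemma tensor_act_sum (J : finType) (w : J -> seq I -> M) s :
  tensor_act g (fun r => \sum_j w j r) s = \sum_j tensor_act g (w j) s.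
Proof.
elim: s w => //= a s IH w; rewrite exchange_big /=; apply: eq_bigr => k _.
by rewrite IH scaler_sumr.
Qed.

Lemma tensor_act_alternating w : alternating w -> alternating (tensor_act g w).
Proof.
move=> hw s; elim: s w hw => [|c s IH] w hw a b t /=.
  under eq_bigr do rewrite scaler_sumr.
  under [X in _ = - X]eq_bigr do rewrite scaler_sumr.
  rewrite exchange_big -sumrN; apply: eq_bigr => k _ /=.
  rewrite -sumrN; apply: eq_bigr => l _.
  rewrite -!scalerN -tensor_actN !scalerA mulrC; congr (_ *: _).
  by apply: eq_tensor_act => r _; apply: alternating_swap.
rewrite -sumrN; apply: eq_bigr => k _; rewrite -scalerN IH //.
exact: alternating_tail.
Qed.

Lemma tensor_act_alt_tensor j w : alt_tensor j w -> alt_tensor j (tensor_act g w).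
Proof.
move=> [hw w0]; split; first exact: tensor_act_alternating.
by move=> t tj; apply: tensor_act_size0 => r rt; apply: w0; rewrite rt.
Qed.

End Basics.

Lemma eq_tensor_act_mx (M : lmodType K) (g h : I -> I -> K) (w : seq I -> M) s :
  (forall a k, g a k = h a k) -> tensor_act g w s = tensor_act h w s.
Proof.
by move=> gh; elim: s w => //= a s IH w; apply: eq_bigr => k _; rewrite gh IH.
Qed.

Lemma tensor_act_comp (M : lmodType K) (g h : I -> I -> K) (w : seq I -> M) s :
  tensor_act g (tensor_act h w) s = tensor_act (fun a k => \sum_l g a l * h l k) w s.
Proof.
elim: s w => //= a s IH w.
under eq_bigr do rewrite tensor_act_sum scaler_sumr.
rewrite exchange_big; apply: eq_bigr => k _ /=.
rewrite -IH scaler_suml; apply: eq_bigr => l _.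
by rewrite tensor_actZ scalerA.
Qed.

(** The coordinates of the image of w at the word s are the values of w at the
    linear forms given by the rows of g listed in s. *)
Lemma tensor_act_rows (M : lmodType K) (g : I -> I -> K) (f : I -> I) (w : seq I -> M) s :
  (forall a, a \in s -> forall k, g a k = (k == f a)%:R) ->
  tensor_act g w s = w (map f s).
Proof.
elim: s w => //= a s IH w gf.
rewrite (bigD1 (f a)) //= gf ?mem_head // eqxx scale1r big1 ?addr0.
  by apply: (IH (fun r => w (f a :: r))) => b bs; apply: gf; rewrite inE bs orbT.
by move=> k ka; rewrite gf ?mem_head // (negbTE ka) scale0r.
Qed.

Lemma tensor_act1 (M : lmodType K) (w : seq I -> M) s :
  tensor_act (fun a k => (k == a)%:R) w s = w s.
Proof. by rewrite (tensor_act_rows (f := id)) ?map_id. Qed.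

Section Wedge.
Variable M : lmodType K.
Hypothesis M2 : two_free M.
Implicit Types (w : seq I -> M) (v u : I -> K).

Definition ext_vec v w : seq I -> M := ext (fun k => *:%R (v k)) w.

Lemma ext_vec_cons v w k t :
  ext_vec v w (k :: t) = v k *: w t - ext_vec v (fun s => w (k :: s)) t.
Proof. by []. Qed.

Lemma ext_vecD v w w' t : ext_vec v (fun s => w s + w' s) t = ext_vec v w t + ext_vec v w' t.
Proof. exact: (@extD _ M M (fun k => *:%R (v k))). Qed.

Lemma ext_vecN v w t : ext_vec v (fun s => - w s) t = - ext_vec v w t.
Proof. exact: (@extN _ M M (fun k => *:%R (v k))). Qed.

Lemma ext_vec_sum v (J : finType) (w : J -> seq I -> M) t :
  ext_vec v (fun s => \sum_i w i s) t = \sum_i ext_vec v (w i) t.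
Proof. exact: (@ext_sum _ M M (fun k => *:%R (v k))). Qed.

Lemma ext_vec0 v t : ext_vec v (fun=> 0) t = 0.
Proof. exact: (@ext0 _ M M (fun k => *:%R (v k))). Qed.

Lemma ext_vecZ v c w t : ext_vec v (fun s => c *: w s) t = c *: ext_vec v w t.
Proof.
elim: t w => [|k t IH] w; first by rewrite /= scaler0.
by rewrite !ext_vec_cons IH scalerBr !scalerA mulrC.
Qed.

Lemma ext_vec_comb c v u w t :
  ext_vec (fun a => c * v a + u a) w t = c *: ext_vec v w t + ext_vec u w t.
Proof.
elim: t w => [|k t IH] w; first by rewrite /= scaler0 addr0.
by rewrite !ext_vec_cons IH scalerDl -scalerA scalerBr opprD addrACA.
Qed.

Lemma ext_vec0l w t : ext_vec (fun=> 0) w t = 0.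
Proof. by elim: t w => // k t IH w; rewrite ext_vec_cons IH scale0r subr0. Qed.

Lemma ext_vec_alt_tensor v j w : alt_tensor j w -> alt_tensor j.+1 (ext_vec v w).
Proof. exact: (@ext_alt_tensor _ M M (fun k => *:%R (v k))). Qed.

Lemma ext_vecC u v w t : ext_vec u (ext_vec v w) t = - ext_vec v (ext_vec u w) t.
Proof.
elim: t w => [|k t IH] w; first by rewrite /= oppr0.
have E x y (z : seq I -> M) : ext_vec x (fun s => ext_vec y z (k :: s)) t =
    y k *: ext_vec x z t - ext_vec x (ext_vec y (fun s => z (k :: s))) t.
  by rewrite -ext_vecZ -ext_vecN -ext_vecD.
rewrite !(ext_vec_cons _ (ext_vec _ _)) !E IH opprK opprB opprD.
by rewrite addrA addrAC.
Qed.

Lemma ext_vec_sq v w t : ext_vec v (ext_vec v w) t = 0.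
Proof. by apply: M2; rewrite {1}ext_vecC addNr. Qed.

Definition ext_vecs (vs : seq (I -> K)) w : seq I -> M := foldr ext_vec w vs.

Lemma ext_vecs_cat vs us w : ext_vecs (vs ++ us) w = ext_vecs vs (ext_vecs us w).
Proof. exact: foldr_cat. Qed.

Lemma ext_vecs_comb vs c w w' t :
  ext_vecs vs (fun s => c *: w s + w' s) t = c *: ext_vecs vs w t + ext_vecs vs w' t.
Proof.
elim: vs t => //= v vs IH t.
rewrite -ext_vecZ -ext_vecD; apply: eq_ext => s _; exact: IH.
Qed.

Lemma ext_vecs0 vs t : ext_vecs vs (fun=> 0) t = 0.
Proof.
elim: vs t => //= v vs IH t; rewrite -[RHS](ext_vec0 v t).
by apply: eq_ext => s _; apply: IH.
Qed.

Lemma ext_vecs_repeat (v : nat -> I -> K) j i w t : (i < j)%N ->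
  ext_vecs (mkseq v j) (ext_vec (v i) w) t = 0.
Proof.
rewrite /mkseq => ij.
have : i \in iota 0 j by rewrite mem_iota.
elim: (iota 0 j) t => //= k r IH t; rewrite inE => /orP[/eqP <-|ir].
  have [ir|nir] := boolP (i \in r).
    by rewrite -[RHS](ext_vec0 (v i) t); apply: eq_ext => s _; apply: IH.
  elim: r {IH nir} t => [|l r IH] t; first exact: ext_vec_sq.
  rewrite /= ext_vecC -[RHS]oppr0; congr (- _); rewrite -[RHS](ext_vec0 (v l) t).
  by apply: eq_ext => s _; apply: IH.
by rewrite -[RHS](ext_vec0 (v k) t); apply: eq_ext => s _; apply: IH.
Qed.

Lemma eq_ext_vec v u w t : (forall a, v a = u a) -> ext_vec v w t = ext_vec u w t.
Proof. by move=> vu; congr (ext_vec _ _ _); apply: funext. Qed.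

(** In v_0 /\ ... /\ v_(j-1) /\ gv_j the terms of gv_j in the v_i with i < j
    disappear [ext_vecs_repeat], which leaves d_j v_j. *)
Lemma ext_vecs_triangular (v gv : nat -> I -> K) (d : nat -> K)
    (c : nat -> nat -> K) (j m : nat) w t :
  (forall k a, (j <= k < j + m)%N ->
     gv k a = d k * v k a + \sum_(i < k) c k i * v i a) ->
  ext_vecs (mkseq v j) (ext_vecs [seq gv k | k <- iota j m] w) t =
  (\prod_(j <= k < j + m) d k) *: ext_vecs (mkseq v (j + m)) w t.
Proof.
elim: m j t => [|m IH] j t gvE.
  by rewrite addn0 big_geq // scale1r.
have := IH j.+1 t; rewrite addSnnS => IHj.
rewrite big_ltn; last by rewrite addnS ltnS leq_addr.
rewrite -scalerA -IHj; last first.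
  by move=> k a /andP[jk kj]; rewrite gvE // (ltnW jk).
rewrite (_ : mkseq v j.+1 = mkseq v j ++ [:: v j]); last first.
  by rewrite /mkseq -addn1 iotaD map_cat.
rewrite ext_vecs_cat; change (ext_vecs (mkseq v j) (ext_vec (gv j)
  (ext_vecs [seq gv k | k <- iota j.+1 m] w)) t = d j *: ext_vecs (mkseq v j)
  (ext_vec (v j) (ext_vecs [seq gv k | k <- iota j.+1 m] w)) t).
set Y := ext_vecs _ w.
transitivity (ext_vecs (mkseq v j) (fun s => d j *: ext_vec (v j) Y s +
   \sum_(i < j) c j i *: ext_vec (v i) Y s) t).
  congr (ext_vecs _ _ t); apply: funext => s.
  rewrite (eq_ext_vec (u := fun a => d j * v j a + \sum_(i < j) c j i * v i a)).
    rewrite ext_vec_comb; congr (_ + _).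
    have S (r : seq 'I_j) : ext_vec (fun a => \sum_(i <- r) c j i * v i a) Y s =
       \sum_(i <- r) c j i *: ext_vec (v i) Y s.
      elim: r => [|i r IHr].
        by rewrite big_nil -[RHS](ext_vec0l Y s); apply: eq_ext_vec => a; rewrite big_nil.
      by rewrite big_cons -IHr -ext_vec_comb; apply: eq_ext_vec => a; rewrite big_cons.
    exact: S.
  by move=> a; apply: gvE; rewrite leqnn addnS ltnS leq_addr.
rewrite ext_vecs_comb [X in _ + X](_ : _ = 0) ?addr0 //.
have S (r : seq 'I_j) :
   ext_vecs (mkseq v j) (fun s => \sum_(i <- r) c j i *: ext_vec (v i) Y s) t = 0.
  elim: r => [|i r IHr].
    rewrite -[RHS](ext_vecs0 (mkseq v j) t); congr (ext_vecs _ _ t).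
    by apply: funext => s; rewrite big_nil.
  transitivity (ext_vecs (mkseq v j) (fun s => c j i *: ext_vec (v i) Y s +
     \sum_(i <- r) c j i *: ext_vec (v i) Y s) t).
    by congr (ext_vecs _ _ t); apply: funext => s; rewrite big_cons.
  by rewrite ext_vecs_comb IHr addr0 ext_vecs_repeat ?scaler0.
exact: S.
Qed.

Lemma ext_vec_vanish v w c t : v c = 0 -> (forall r, c \in r -> w r = 0) ->
  c \in t -> ext_vec v w t = 0.
Proof.
move=> vc; elim: t w => // a t IH w wc.
rewrite inE ext_vec_cons => /predU1P[ca|ct].
  rewrite -ca vc scale0r (_ : ext_vec v (fun s => w (c :: s)) t = 0) ?subrr //.
  rewrite -[RHS](ext_vec0 v t); apply: eq_ext => s _.
  by rewrite wc ?mem_head.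
by rewrite wc // scaler0 IH ?subrr // => r cr; apply: wc; rewrite inE cr orbT.
Qed.

Definition unit_vec (k a : I) : K := (a == k)%:R.

(** On a form of degree j, the sum over a basis of the exterior products with
    the contractions is multiplication by j. *)
Lemma ext_vec_contract w t : alternating w ->
  \sum_k ext_vec (unit_vec k) (fun s => w (k :: s)) t = w t *+ size t.
Proof.
elim: t w => [|a t IH] w hw; first by rewrite big1.
under eq_bigr do rewrite ext_vec_cons.
rewrite sumrB (bigD1 a) //= /unit_vec eqxx scale1r big1 ?addr0; last first.
  by move=> k ka; rewrite eq_sym (negbTE ka) scale0r.
rewrite mulrS; congr (_ + _).
rewrite -(IH (fun s => w (a :: s))); last exact: alternating_tail.
rewrite -sumrN; apply: eq_bigr => k _; rewrite -ext_vecN.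
apply: eq_ext => s _ /=; rewrite (alternating_swap hw); exact: opprK.
Qed.

Lemma tensor_act_ext_vec g v w t :
  tensor_act g (ext_vec v w) t = ext_vec (fun a => \sum_k g a k * v k) (tensor_act g w) t.
Proof.
elim: t w => // a t IH w; rewrite ext_vec_cons /=.
transitivity (\sum_k g a k *: (v k *: tensor_act g w t
    - ext_vec (fun a => \sum_k g a k * v k) (tensor_act g (fun r => w (k :: r))) t)).
  apply: eq_bigr => k _; congr (_ *: _).
  by rewrite -IH -tensor_actZ -tensor_actN -tensor_actD.
under [LHS]eq_bigr do rewrite scalerBr scalerA.
rewrite sumrB -scaler_suml; congr (_ - _).
by under [LHS]eq_bigr do rewrite -ext_vecZ; rewrite -ext_vec_sum.
Qed.

End Wedge.

Definition wedge (vs : seq (I -> K)) : seq I -> K :=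
  ext_vecs vs (fun t => (t == [::])%:R : K^o).

Lemma wedge_cons v vs : wedge (v :: vs) = ext_vec v (wedge vs : seq I -> K^o).
Proof. by []. Qed.

Lemma wedge_alt_tensor vs : alt_tensor (size vs) (wedge vs).
Proof.
elim: vs => [|v vs IH]; last exact: (@ext_vec_alt_tensor K^o).
split=> [s a b t|[|a t]] //; first by rewrite /wedge /=; case: s => //=; rewrite oppr0.
Qed.

Lemma wedge_unit0 (q : seq I) c t : c \notin q -> c \in t ->
  wedge (map unit_vec q) t = 0.
Proof.
elim: q t => [|b q IH] t; first by case: t.
rewrite inE negb_or => /andP[cb cq] ct; rewrite map_cons wedge_cons.
apply: (@ext_vec_vanish K^o _ _ c) => // [|s]; first by rewrite /unit_vec (negbTE cb).
exact: IH.
Qed.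

Lemma wedge_unit_self r : uniq r -> wedge (map unit_vec r) r = 1.
Proof.
elim: r => // a r IH; rewrite cons_uniq => /andP[ar ur].
rewrite map_cons wedge_cons ext_vec_cons {1}/unit_vec eqxx scale1r IH //.
rewrite (_ : ext_vec _ _ r = 0) ?subr0 // -(ext_vec0 K^o (unit_vec a) r).
by apply: eq_ext => s _; apply: (wedge_unit0 (c := a)); rewrite ?mem_head.
Qed.

Lemma tensor_act_wedge g vs t :
  tensor_act (M := K^o) g (wedge vs) t = wedge [seq (fun a => \sum_k g a k * v k) | v <- vs] t.
Proof.
elim: vs t => [|v vs IH] t.
  case: t => //= a t; rewrite big1 // => k _.
  by rewrite (@tensor_act0 K^o) scaler0.
rewrite map_cons !wedge_cons tensor_act_ext_vec; apply: eq_ext => s _; exact: IH.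
Qed.

End TensorPower.

(** Only the entries of g need to be compatible with f, which allows maps f that
    are linear over a subring only. *)
Lemma tensor_act_map (n : nat) (K L : comNzRingType) (M : lmodType K) (N : lmodType L)
    (f : M -> N) (g : 'I_n -> 'I_n -> K) (h : 'I_n -> 'I_n -> L) (w : seq 'I_n -> M) s :
  {morph f : x y / x + y} -> f 0 = 0 ->
  (forall a k x, f (g a k *: x) = h a k *: f x) ->
  f (tensor_act g w s) = tensor_act h (fun r => f (w r)) s.
Proof.
move=> fD f0 fZ; elim: s w => //= a s IH w.
by rewrite (big_morph f fD f0); apply: eq_bigr => k _; rewrite fZ IH.
Qed.

(** * Tensors alternating in all but the first argument *)

(** Vanishing outside the zeros of P, the product P * Q vanishes everywhere. *)
Lemma poly_eq0_generic (C : numFieldType) (P Q : {poly C}) :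
  P != 0 -> (forall x, P.[x] != 0 -> Q.[x] = 0) -> Q = 0.
Proof.
move=> P0 PQ; suff /eqP : P * Q = 0 by rewrite mulf_eq0 (negbTE P0) => /eqP.
apply/eqP; apply: contraT => PQ0.
have := max_poly_roots PQ0 (rs := [seq i%:R | i <- iota 0 (size (P * Q))]).
rewrite size_map size_iota ltnn => -> //.
  apply/allP => x _; rewrite rootE hornerM.
  by have [->|/PQ ->] := eqVneq P.[x] 0; rewrite ?mul0r ?mulr0.
by rewrite map_inj_uniq ?iota_uniq // => i j /eqP; rewrite eqr_nat => /eqP.
Qed.

(** Membership in a subspace of functions is tested by linear forms; this
    reduces the closure properties of invariant subspaces to identities
    between polynomials. *)
Lemma memv_dual (C : fieldType) (J : finType) (U : {vspace {ffun J -> C^o}})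
    (x : {ffun J -> C^o}) :
  (forall c : J -> C, (forall u, u \in U -> \sum_j c j * u j = 0) ->
     \sum_j c j * x j = 0) -> x \in U.
Proof.
move=> xU.
pose T := {ffun J -> C^o} : vectType C.
pose del j : T := [ffun i => (i == j)%:R].
have delE (y : T) : y = \sum_j y j *: del j.
  apply/ffunP => i; rewrite sum_ffunE (bigD1 i) //= !ffunE eqxx.
  rewrite big1 => [|j ji]; first by rewrite addr0 /GRing.scale /= mulr1.
  by rewrite !ffunE eq_sym (negbTE ji) scaler0.
pose f (y : T) := y - projv U y.
have lam k y : coord (vbasis {:T}) k (f y) =
    \sum_j coord (vbasis {:T}) k (f (del j)) * y j.
  rewrite {1}[y]delE /f linear_sum /= -sumrB linear_sum; apply: eq_bigr => j _.
  by rewrite linearZ /= -scalerBr linearZ /= mulrC.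
have fU u : u \in U -> f u = 0 by move=> uU; rewrite /f projv_id ?subrr.
suff : f x = 0 by move/eqP; rewrite subr_eq0 => /eqP ->; apply: memv_proj.
rewrite (coord_vbasis (memvf (f x))) big1 // => k _.
rewrite lam xU ?scale0r // => u uU.
by rewrite -lam fU // linear0.
Qed.

Section HookTensors.
Variables (n : nat) (C : numFieldType).
Local Notation I := 'I_n.
Implicit Types (w : seq I -> C) (g : I -> I -> C).

Local Notation tact g w := (@tensor_act n C C^o g w).
Local Notation vext v w := (@ext_vec n C C^o v w).
Local Notation e := (@unit_vec n C).

Lemma two_free_num : two_free C^o.
Proof.
by move=> x /eqP; rewrite -mulr2n -mulr_natr mulf_eq0 pnatr_eq0 orbF => /eqP.
Qed.

(** The elements of V (x) /\V. *)
Definition tail_alternating w := forall a, alternating (fun t => w (a :: t)).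

(** The Koszul map from V (x) /\^p V to S^2 V (x) /\^(p-1) V. *)
Definition symmetrize2 w (s : seq I) : C :=
  if s is a :: b :: t then w (a :: b :: t) + w (b :: a :: t) else 0.

(** The tensor product of x and w. *)
Definition pure (x : I -> C) w (s : seq I) : C :=
  if s is a :: t then x a * w t else 0.

Lemma tensor_act_tail_alternating g w :
  tail_alternating w -> tail_alternating (tact g w).
Proof.
move=> hw a /=; apply: alternating_sum => k s b c t.
rewrite /= -mulrN; congr (_ * _).
by apply: (@tensor_act_alternating n C C^o).
Qed.

Lemma tensor_act_symmetrize2 g w s :
  tact g (symmetrize2 w) s = symmetrize2 (tact g w) s.
Proof.
case: s => [|a [|b t]] //=.
  by rewrite big1 // => k _; rewrite scaler0.
rewrite [X in _ = _ + X](_ : _ = \sum_k g a k *: \sum_l g b l *: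
    tact g (fun r => w (l :: k :: r)) t); last first.
  under eq_bigr do rewrite scaler_sumr.
  rewrite exchange_big; apply: eq_bigr => k _ /=; rewrite scaler_sumr.
  by apply: eq_bigr => l _; rewrite !scalerA mulrC.
rewrite -big_split; apply: eq_bigr => k _ /=; rewrite -scalerDr -big_split /=.
by congr (_ *: _); apply: eq_bigr => l _; rewrite -scalerDr tensor_actD.
Qed.

Lemma tensor_act_pure g x w s :
  tact g (pure x w) s = pure (fun a => \sum_k g a k * x k) (tact g w) s.
Proof.
case: s => //= a t; rewrite mulr_suml; apply: eq_bigr => k _.
by rewrite -mulrA; congr (_ * _); exact: (@tensor_actZ n C C^o g (x k) w t).
Qed.

Lemma pure_wedge_tail_alternating x vs : tail_alternating (pure x (wedge vs)).
Proof.
by move=> a s b c t /=; rewrite (wedge_alt_tensor vs).1 mulrN.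
Qed.

Lemma symmetrize2_eq0 w : alternating w -> forall s, symmetrize2 w s = 0.
Proof. by move=> hw [|a [|b t]] //=; rewrite (alternating_swap hw) addNr. Qed.

Lemma symmetrize2_alternating w a b : tail_alternating w ->
  alternating (fun t => symmetrize2 w (a :: b :: t)).
Proof.
move=> hw; apply: alternatingD.
  exact: (alternating_tail b (hw a)).
exact: (alternating_tail a (hw b)).
Qed.

(** The map S^2 V (x) /\^(p-1) V -> V (x) /\^p V that sends u to the sum of the
    e_a (x) (e_k /\ u(k, a, -)). *)
Definition resymmetrize (u : seq I -> C) (s : seq I) : C :=
  if s is a :: t then \sum_k vext (e k) (fun r => u (k :: a :: r)) t else 0.

(** Let w have order p + 1 and let b be the sum of the e_k /\ w(k, -), a totally
    alternating tensor.  Expanding u = symmetrize2 w gives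
    resymmetrize u = (p + 1) w - b, and [symmetrize2] kills b.  Hence
    symmetrize2 w is recovered, up to the factor p + 1, from tensors of the
    form e_a (x) (e_k /\ r) symmetrized in a and k. *)
Lemma symmetrize2_resymmetrize w s : tail_alternating w ->
  symmetrize2 (resymmetrize (symmetrize2 w)) s = (symmetrize2 w s) *+ size s.
Proof.
move=> hw.
pose b r := \sum_k vext (e k) (fun q => w (k :: q)) r.
have hb : alternating b.
  apply: alternating_sum => k; exact: (@ext_alternating _ _ _ (fun i => *:%R (e k i))).
have E a t : resymmetrize (symmetrize2 w) (a :: t) = w (a :: t) *+ (size t).+1 - b (a :: t).
  rewrite /= /b; under eq_bigr do rewrite ext_vecD; rewrite big_split /=.
  rewrite (@ext_vec_contract n C C^o (fun q => w (a :: q))) //.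
  have -> : \sum_k vext (e k) (fun q => w (k :: q)) (a :: t) =
      w (a :: t) - \sum_k vext (e k) (fun q => w (k :: a :: q)) t.
    under eq_bigr do rewrite ext_vec_cons.
    rewrite sumrB (bigD1 a) //= /unit_vec eqxx scale1r big1 ?addr0 // => k ka.
    by rewrite eq_sym (negbTE ka) scale0r.
  by rewrite mulrSr opprB addrA addrAC addrK addrC.
case: s => [|a [|c t]]; [by []|by rewrite mul0rn|].
rewrite /symmetrize2 -/(symmetrize2 w) !E /=.
rewrite (alternating_swap hb a c) opprK mulrnDl.
by rewrite addrACA addrN addr0.
Qed.

Lemma wedge_unit_perm (q t : seq I) : uniq q -> size t = size q ->
  wedge (map e q) t != 0 -> perm_eq t q.
Proof.
move=> uq tq tn0.
have ut : uniq t.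
  apply: contraNT tn0 => nut.
  have [hq _] := wedge_alt_tensor (map e q).
  by rewrite (alternating_nuniq two_free_num hq nut).
have tsub : {subset t <= q}.
  move=> c ct; apply: contraNT tn0 => cq; by rewrite (wedge_unit0 _ cq ct).
by apply: uniq_perm => //; apply: (uniq_min_size ut tsub _).2; rewrite tq.
Qed.

(** /\^p of a space of dimension p is a line: both sides are alternating and
    agree at q. *)
Lemma alternating_top w (q t : seq I) : uniq q -> size t = size q ->
  alternating w -> (forall c s, c \notin q -> c \in s -> w s = 0) ->
  w t = w q * wedge (map e q) t.
Proof.
move=> uq tq hw wq.
have [pt|npt] := boolP (perm_eq t q); last first.
  rewrite [wedge _ _](_ : _ = 0) ?mulr0; last first.
    by apply/eqP; apply: contraR npt; apply: wedge_unit_perm.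
  apply/eqP; apply: contraR npt => wt.
  have ut : uniq t.
    by apply: contraNT wt => nut; rewrite (@alternating_nuniq _ C^o _ _ two_free_num hw nut).
  have tsub : {subset t <= q}.
    by move=> c ct; apply: contraNT wt => cq; rewrite (wq c).
  by apply: uniq_perm => //; apply: (uniq_min_size ut tsub _).2; rewrite tq.
apply/eqP; rewrite -subr_eq0; apply/eqP.
have [hq _] := wedge_alt_tensor (map e q).
apply: (@alternating_perm0 _ C (fun s => w s - w q * wedge (map e q) s) q).
- by move=> s a b r; rewrite hw hq mulrN opprD.
- by rewrite perm_sym.
- by rewrite wedge_unit_self // mulr1 subrr.
Qed.

(** The products of unit vectors span the alternating tensors of order m; the
    induction applies [ext_vec_contract]. *)
Lemma wedge_span m (L : (seq I -> C) -> C) :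
  (forall c w w', L (fun s => c * w s + w' s) = c * L w + L w') ->
  (forall w w', (forall s, size s = m -> w s = w' s) -> L w = L w') ->
  (forall q, size q = m -> L (wedge (map e q)) = 0) ->
  forall w, alternating w -> L w = 0.
Proof.
elim: m L => [|m IH] L Llin Lsize Lq w hw; have L0 : L (fun=> 0) = 0.
- transitivity (L (fun s : seq I => -1 * 0 + 0)); last by rewrite Llin mulN1r addNr.
  by congr (L _); apply: funext => s; rewrite mulr0 addr0.
- have := Llin (w [::]) (wedge [::]) (fun=> 0).
  rewrite L0 addr0 (Lq [::]) // mulr0 => E; rewrite -[RHS]E; apply: Lsize => -[] // _.
  by rewrite addr0 mulr1.
- transitivity (L (fun s : seq I => -1 * 0 + 0)); last by rewrite Llin mulN1r addNr.
  by congr (L _); apply: funext => s; rewrite mulr0 addr0.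
have Lk k : L (vext (e k) (fun s => w (k :: s))) = 0.
  apply: (IH (fun w' => L (vext (e k) w'))); last exact: alternating_tail.
  - move=> c w1 w2; rewrite -Llin; congr (L _); apply: funext => s.
    rewrite (@ext_vecD n C C^o (e k) (fun s => c * w1 s) w2); congr (_ + _).
    exact: (@ext_vecZ n C C^o).
  - move=> w1 w2 w12; apply: Lsize => s sm; apply: eq_ext => r rs.
    by apply: w12; apply: succn_inj; rewrite rs.
  - by move=> q qm; apply: (Lq (k :: q)); rewrite /= qm.
have Lsum (r : seq I) : L (fun s => \sum_(k <- r) vext (e k) (fun s => w (k :: s)) s) = 0.
  elim: r => [|k r IHr].
    by rewrite -[RHS]L0; congr (L _); apply: funext => s; rewrite big_nil.
  have := Llin 1 (vext (e k) (fun s => w (k :: s)))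
    (fun s => \sum_(k <- r) vext (e k) (fun s => w (k :: s)) s).
  rewrite Lk IHr mulr0 addr0 => E; rewrite -[RHS]E.
  by congr (L _); apply: funext => s; rewrite big_cons mul1r.
have := Llin m.+1%:R w (fun=> 0); rewrite L0 addr0.
rewrite (Lsize _ (fun s => \sum_k vext (e k) (fun s => w (k :: s)) s)); last first.
  by move=> s sm; rewrite (@ext_vec_contract n C C^o) // sm addr0 mulr_natl.
rewrite Lsum => /esym /eqP; rewrite mulf_eq0 pnatr_eq0 /=.
by move/eqP.
Qed.

End HookTensors.

(** * Invariant subspaces: generation by the highest weight vector *)

Section PackedTensors.
Variables (n : nat) (C : numFieldType) (d : nat).
Local Notation I := 'I_n.
Implicit Types (w : seq I -> C) (g : I -> I -> C).

Local Notation tact g w := (@tensor_act n C C^o g w).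
Local Notation T := {ffun d.-tuple I -> C^o}.

(** Restriction to words of length d, which form a finite set. *)
Definition pack w : T := [ffun s => w (tval s)].
Definition unpack (u : T) (s : seq I) : C := if insub s is Some t then u t else 0.

Lemma packK w s : size s = d -> unpack (pack w) s = w s.
Proof.
move=> sd; rewrite /unpack; case: insubP => [t _ <-|/negP[]]; first by rewrite ffunE.
exact/eqP.
Qed.

Lemma unpackE (u : T) (s : d.-tuple I) : unpack u s = u s.
Proof. by rewrite /unpack valK. Qed.

Lemma unpackK : cancel unpack pack.
Proof. by move=> u; apply/ffunP => s; rewrite ffunE unpackE. Qed.

Lemma eq_pack w w' : (forall s, size s = d -> w s = w' s) -> pack w = pack w'.
Proof.
by move=> ww'; apply/ffunP => s; rewrite !ffunE ww' // size_tuple.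
Qed.

Lemma packP c w w' : pack (fun s => c * w s + w' s) = c *: pack w + pack w'.
Proof. by apply/ffunP => s; rewrite !ffunE. Qed.

Definition packed_act g (u : T) : T := pack (tact g (unpack u)).

Lemma packed_act_pack g w : packed_act g (pack w) = pack (tact g w).
Proof.
apply: eq_pack => s sd; apply: (@eq_tensor_act n C C^o) => r rs; apply: packK; by rewrite rs.
Qed.

Fact packed_act_linear g : linear (packed_act g).
Proof.
move=> c u v; rewrite -packP; apply: eq_pack => s sd.
rewrite -[RHS](@tensor_actP n C C^o g c (unpack u) (unpack v)).
apply: (@eq_tensor_act n C C^o) => r _; rewrite /unpack; case: insub => [t|]; first by rewrite !ffunE.
by rewrite scaler0 addr0.
Qed.

HB.instance Definition _ g := GRing.isLinear.Build C T T *:%R (packed_act g) (packed_act_linear g).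

Lemma packed_act_comp g h (u : T) :
  packed_act g (packed_act h u) = packed_act (fun a k => \sum_l g a l * h l k) u.
Proof.
by rewrite packed_act_pack; apply: eq_pack => s _; apply: (@tensor_act_comp n C C^o).
Qed.

Lemma eq_packed_act g h (u : T) : (forall a k, g a k = h a k) -> packed_act g u = packed_act h u.
Proof. by move=> gh; apply: eq_pack => s _; apply: (@eq_tensor_act_mx n C C^o). Qed.

Lemma packed_act1 (u : T) : packed_act (fun a k => (k == a)%:R) u = u.
Proof. by rewrite -[RHS]unpackK; apply: eq_pack => s _; apply: (@tensor_act1 n C C^o). Qed.

(** For a linear form c that kills U, the value of c at (g + T) u is a polynomial
    in T.  It vanishes whenever det (g + T) does not, hence also at T = 0. *)
Lemma packed_act_stable (U : {vspace T}) :
  (forall g : 'M[C]_n, g \in unitmx -> forall u, u \in U -> packed_act g u \in U) ->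
  forall g u, u \in U -> packed_act g u \in U.
Proof.
move=> Ugl g u uU; apply: memv_dual => c cU.
pose G : 'M[C]_n := \matrix_(i, j) g i j.
(* Q is the value of c at (g + 'X) u *)
pose gX a k : {poly C} := (g a k)%:P + (a == k)%:R * 'X.
pose wX r : {poly C}^o := (unpack u r)%:P.
pose Q : {poly C} := \sum_(s : d.-tuple I) (c s)%:P *
  (@tensor_act n {poly C} {poly C}^o gX wX s : {poly C}).
have QE x : Q.[x] = \sum_s c s * packed_act (fun a k => g a k + (a == k)%:R * x) u s.
  rewrite /Q horner_sum; apply: eq_bigr => s _; rewrite hornerM hornerC ffunE.
  have hD : {morph (fun p : {poly C}^o => p.[x] : C^o) : p q / p + q}.
    by move=> p q; apply: hornerD.
  have hZ (p : {poly C}) (q : {poly C}^o) : ((p *: q).[x] : C^o) = p.[x] *: (q.[x] : C^o).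
    exact: hornerM.
  congr (_ * _).
  rewrite (tensor_act_map wX s hD (horner0 x) (fun a k => hZ (gX a k))).
  under eq_tensor_act do rewrite /wX hornerC.
  apply: (@eq_tensor_act_mx n C C^o) => a k.
  by rewrite /gX !hornerE; case: (a == k); rewrite ?hornerE.
have Q0 : Q = 0.
  apply: (@poly_eq0_generic _ (char_poly (- G))).
    by rewrite monic_neq0 // char_poly_monic.
  move=> x Px; rewrite QE; apply: cU.
  pose H : 'M[C]_n := \matrix_(a, k) (g a k + (a == k)%:R * x).
  rewrite (@eq_packed_act _ H) => [|a k]; last by rewrite mxE.
  apply: Ugl => //; rewrite unitmxE unitfE; move: Px.
  rewrite /char_poly -horner_evalE -det_map_mx; congr (\det _ != 0).
  apply/matrixP => a k; rewrite !mxE /= horner_evalE hornerD hornerN hornerC hornerMn.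
  by rewrite hornerX opprK addrC mulr_natl.
transitivity Q.[0]; last by rewrite Q0 horner0.
rewrite QE; apply: eq_bigr => s _; congr (_ * _).
by congr (fun_of_fin _ s); apply: eq_packed_act => a k; rewrite mulr0 addr0.
Qed.

End PackedTensors.

Section HookIrreducible.
Variables (n : nat) (C : numFieldType) (p' : nat).
Local Notation I := 'I_n.
Implicit Types (w : seq I -> C) (g : I -> I -> C).
Local Notation tact g w := (@tensor_act n C C^o g w).
Local Notation vext v w := (@ext_vec n C C^o v w).
Local Notation e := (@unit_vec n C).
Local Notation T := {ffun p'.+2.-tuple I -> C^o}.

(** Two-argument symmetrization kills exactly the totally alternating tensors,
    so that this image is the cokernel of /\^(p+1) V -> V (x) /\^p V for
    p = p' + 1. *)
Definition hook_tensor (u : T) : Prop :=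
  exists2 w, tail_alternating w & u = pack p'.+2 (symmetrize2 w).

Lemma hook_tensor_closed c u v :
  hook_tensor u -> hook_tensor v -> hook_tensor (c *: u + v).
Proof.
move=> [w hw ->] [w' hw' ->]; exists (fun s => c * w s + w' s).
  by move=> a s b x t; rewrite hw hw' mulrN opprD.
rewrite -packP; apply: eq_pack => -[|a [|b t]] _ /=; rewrite ?mulr0 ?addr0 //.
by rewrite mulrDr addrACA.
Qed.

Lemma hook_tensor0 : hook_tensor 0.
Proof.
exists (fun=> 0); first by move=> a s b x t; rewrite oppr0.
by apply/ffunP => s; rewrite !ffunE symmetrize2_eq0 // => a b x t; rewrite oppr0.
Qed.

Lemma packed_act_hook_tensor g u : hook_tensor u -> hook_tensor (packed_act g u).
Proof.
move=> [w hw ->]; exists (tact g w); first exact: tensor_act_tail_alternating.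
by rewrite packed_act_pack; apply: eq_pack => s _; apply: tensor_act_symmetrize2.
Qed.

(** An alternating tensor of order greater than n vanishes. *)
Lemma hook_tensor_eq0 u : (n < p'.+1)%N -> hook_tensor u -> u = 0.
Proof.
move=> np [w hw ->]; apply/ffunP => s; rewrite !ffunE.
have w0 a t : size t = p'.+1 -> w (a :: t) = 0.
  move=> tp; apply: (alternating_nuniq (@two_free_num C) (hw a)).
  apply/negP => /card_uniqP tc; have := max_card (mem t).
  by rewrite tc tp card_ord leqNgt np.
case: s => -[|a [|b t]] //= /eqP [tp].
by rewrite !w0 ?addr0 //= tp.
Qed.

Hypothesis np : (p' < n)%N.

Definition first_letters : seq I := take p'.+1 (enum 'I_n).

Lemma val_first_letters : map val first_letters = iota 0 p'.+1.
Proof. by rewrite map_take val_enum_ord take_iota (minn_idPl np). Qed.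

Lemma first_letters_uniq : uniq first_letters.
Proof. by rewrite take_uniq // enum_uniq. Qed.

Lemma size_first_letters : size first_letters = p'.+1.
Proof. by rewrite -(size_map val) val_first_letters size_iota. Qed.

Lemma mem_first_letters a : (a \in first_letters) = (a < p'.+1)%N.
Proof. by rewrite -(mem_map val_inj) val_first_letters mem_iota. Qed.

Definition first_letter : I := Ordinal (leq_ltn_trans (leq0n p') np).

Definition later_letters : seq I := behead first_letters.

Lemma first_letters_cons : first_letters = first_letter :: later_letters.
Proof.
rewrite /later_letters; have := val_first_letters; case: first_letters => //= a s [a0 _].
by congr (_ :: _); apply: val_inj.
Qed.

Lemma map_later_letters (A : Type) (x : A) (s : seq A) : size s = p' ->
  map (fun i : I => nth x s (val i).-1) later_letters = s.
Proof.
move=> sp; have := val_first_letters; rewrite first_letters_cons /= => -[tlE].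
rewrite (map_comp (fun i => nth x s i.-1) val) tlE.
rewrite (_ : iota 1 p' = map S (iota 0 p')); last by rewrite -[1%N]addn0 iotaDl; apply: eq_map.
rewrite -map_comp -[RHS](mkseq_nth x) /mkseq sp.
exact: eq_map.
Qed.

Lemma later_letters_neq a : a \in later_letters -> (a == first_letter) = false.
Proof.
move=> atl; have := first_letters_uniq; rewrite first_letters_cons /= => /andP[h _].
by apply: contraNF h => /eqP <-.
Qed.

(** e_0 (x) (e_0 /\ ... /\ e_p'), of weight (2,1,...,1). *)
Definition highest_tensor : seq I -> C := pure (e first_letter) (wedge (map e first_letters)).

Section Stable.
Variable U : {vspace T}.
Hypothesis U_stable : forall g u, u \in U -> packed_act g u \in U.

(** Apply the matrix that maps e_0 to x and e_1, ..., e_p' to the vectors e_i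
    with i in t. *)
Lemma stable_pure_square : pack p'.+2 (symmetrize2 highest_tensor) \in U ->
  forall x t, size t = p' ->
  pack p'.+2 (symmetrize2 (pure x (wedge (x :: map e t)))) \in U.
Proof.
move=> vU x t tp.
(* column 0 is x, the next p' columns are the unit vectors listed in t *)
pose g a k : C := if k == first_letter then x a else nth (fun=> 0) (map e t) (val k).-1 a.
have := U_stable g vU; rewrite packed_act_pack.
congr (_ \in U); apply: eq_pack => s _; rewrite tensor_act_symmetrize2.
congr symmetrize2; apply: funext => r {s}; rewrite tensor_act_pure.
have colE k : (fun a => \sum_l g a l * e k l) = g^~ k.
  apply: funext => a; rewrite (bigD1 k) //= /unit_vec eqxx mulr1 big1 ?addr0 // => l lk.
  by rewrite (negbTE lk) mulr0.
congr pure; first by rewrite colE; apply: funext => a; rewrite /g eqxx.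
apply: funext => q; rewrite tensor_act_wedge -map_comp; congr (wedge _ q).
rewrite first_letters_cons /=; congr (_ :: _).
  by rewrite colE; apply: funext => a; rewrite /g eqxx.
rewrite -[RHS](map_later_letters (fun=> 0)) ?size_map //.
apply/eq_in_map => k ktl /=; rewrite colE; apply: funext => a.
by rewrite /g later_letters_neq.
Qed.

(** A linear form killing U pulls back along symmetrization to a form lam on
    V (x) /\^p V.  It vanishes at all x (x) (x /\ r), so its value at
    x (x) (y /\ r) is antisymmetric in x and y.  The tensor of
    [symmetrize2_resymmetrize] is a sum of such terms with coefficients
    symmetric in the two vectors, so lam vanishes at it; as its
    symmetrization is that of (p + 1) w, lam vanishes at w. *)
Lemma stable_generation : pack p'.+2 (symmetrize2 highest_tensor) \in U ->
  forall w, tail_alternating w -> pack p'.+2 (symmetrize2 w) \in U.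
Proof.
move=> vU w hw; apply: memv_dual => c cU.
pose lam w' := \sum_s c s * pack p'.+2 (symmetrize2 w') s.
have lamE x w1 w2 : lam (fun s => x * w1 s + w2 s) = x * lam w1 + lam w2.
  rewrite /lam mulr_sumr -big_split; apply: eq_bigr => s _ /=.
  rewrite mulrCA -mulrDr; congr (_ * _); rewrite !ffunE.
  case: (tval s) => [|a [|b t]] /=; rewrite ?mulr0 ?addr0 //.
  by rewrite mulrDr addrACA.
have lam_size w1 w2 : (forall s, size s = p'.+2 -> w1 s = w2 s) -> lam w1 = lam w2.
  move=> w12; apply: eq_bigr => s _; congr (_ * _); rewrite !ffunE.
  by case: s => -[|a [|b t]] //= /eqP ts; rewrite !w12.
have lam_sum (J : finType) (w' : J -> seq I -> C) :
    lam (fun s => \sum_j w' j s) = \sum_j lam (w' j).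
  have lam0 : lam (fun=> 0) = 0.
    rewrite /lam big1 // => s _; rewrite ffunE symmetrize2_eq0 ?mulr0 //.
    by move=> r a b t; rewrite oppr0.
  have S (r : seq J) : lam (fun s => \sum_(j <- r) w' j s) = \sum_(j <- r) lam (w' j).
    elim: r => [|j r IH].
      by rewrite big_nil -[RHS]lam0; congr lam; apply: funext => s; rewrite big_nil.
    rewrite big_cons -IH -[lam (w' j)]mul1r -lamE; congr lam.
    by apply: funext => s; rewrite big_cons mul1r.
  exact: S.
have sq0 x t : size t = p' -> lam (pure x (vext x (wedge (map e t)))) = 0.
  by move=> tp; apply: cU; apply: (stable_pure_square vU).
pose B x y r := lam (pure x (vext y r)).
have BDl x x' y r : B (fun a => 1 * x a + x' a) y r = B x y r + B x' y r.
  rewrite /B -[lam (pure x _)]mul1r -lamE; congr lam; apply: funext => -[|a s] /=.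
    by rewrite mulr0 addr0.
  by rewrite !mul1r mulrDl.
have BDr x y y' r : B x (fun a => 1 * y a + y' a) r = B x y r + B x y' r.
  rewrite /B -[lam (pure x (vext y _))]mul1r -lamE; congr lam; apply: funext => -[|a s] /=.
    by rewrite mulr0 addr0.
  by rewrite ext_vec_comb scale1r mulrDr !mul1r.
have Bsym x y r : alternating r -> B x y r + B y x r = 0.
  move=> hr; apply: (wedge_span (m := p') (L := fun r => B x y r + B y x r)) hr.
  - have BZ c' x' y' w1 w2 : B x' y' (fun s => c' * w1 s + w2 s) = c' * B x' y' w1 + B x' y' w2.
      rewrite /B -lamE; congr lam; apply: funext => -[|a s] /=; first by rewrite mulr0 addr0.
      rewrite (@ext_vecD n C C^o y' (fun s => c' * w1 s) w2).
      by rewrite (@ext_vecZ n C C^o y' c' w1) mulrDr mulrCA.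
    by move=> c' w1 w2; rewrite !BZ mulrDr addrACA.
  - have Bs x' y' w1 w2 : (forall s, size s = p' -> w1 s = w2 s) -> B x' y' w1 = B x' y' w2.
      move=> w12; apply: lam_size => -[|a s] //= [sp]; congr (_ * _).
      by apply: eq_ext => q qs; apply: w12; apply: succn_inj; rewrite qs.
    by move=> w1 w2 w12; congr (_ + _); apply: Bs.
  - move=> q qp; have := sq0 (fun a => 1 * x a + y a) q qp.
    rewrite -/(B _ _ _) BDl !BDr /B !sq0 // add0r addr0; by [].
pose u := symmetrize2 w.
have hu a b : alternating (fun t => u (a :: b :: t)) by apply: symmetrize2_alternating.
have uC k a s : u (k :: a :: s) = u (a :: k :: s) by rewrite /= addrC.
have lamz : lam (resymmetrize u) = 0.
  have -> : lam (resymmetrize u) =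
      \sum_a \sum_k B (e a) (e k) (fun r => u (k :: a :: r)).
    rewrite (lam_size _ (fun s => \sum_a \sum_k
        pure (e a) (vext (e k) (fun r => u (k :: a :: r))) s)).
      by rewrite lam_sum; apply: eq_bigr => a _; rewrite lam_sum.
    move=> -[|a s] // _; rewrite /= [RHS](bigD1 a) //= [X in _ = _ + X]big1.
      by rewrite addr0; apply: eq_bigr => k _; rewrite /unit_vec eqxx mul1r.
    by move=> b ba; rewrite big1 // => k _; rewrite /unit_vec eq_sym (negbTE ba) mul0r.
  apply: (@two_free_num C); rewrite [X in _ + X]exchange_big -big_split big1 // => a _.
  rewrite -big_split big1 // => k _ /=.
  rewrite [X in B (e k) (e a) X](_ : _ = fun r => u (k :: a :: r)); last first.
    by apply: funext => r; rewrite uC.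
  exact: (Bsym (e a) (e k) _ (hu k a)).
have lamu : lam w *+ p'.+2 = 0.
  rewrite -[RHS]lamz /lam -sumrMnl; apply: eq_bigr => s _.
  rewrite -mulrnAr !ffunE symmetrize2_resymmetrize //; congr (_ * _).
  by rewrite size_tuple.
by move/eqP: lamu; rewrite mulrn_eq0 /= => /eqP.
Qed.

End Stable.
End HookIrreducible.

(** * Invariant subspaces: reaching the highest weight vector *)

(** Polarization. *)
Lemma symmetric_form_neq0 (C : numFieldType) (I : finType) (f : I -> I -> C) a b :
  (forall x y, f x y = f y x) -> f a b != 0 ->
  exists l : I -> C, \sum_x l x * (\sum_y l y * f x y) != 0.
Proof.
move=> fC fab.
pose del (c x : I) : C := (x == c)%:R.
have delE c (h : I -> C) : \sum_y del c y * h y = h c.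
  rewrite (bigD1 c) //= /del eqxx mul1r big1 ?addr0 // => y yc.
  by rewrite (negbTE yc) mul0r.
have [faa|faa] := eqVneq (f a a) 0; last first.
  by exists (del a); rewrite delE delE.
have [fbb|fbb] := eqVneq (f b b) 0; last first.
  by exists (del b); rewrite delE delE.
exists (fun x => del a x + del b x).
under eq_bigr do under eq_bigr do rewrite mulrDl.
under eq_bigr do rewrite big_split /= !delE mulrDl.
rewrite big_split /= !delE faa fbb add0r addr0 (fC b a).
by rewrite -mulr2n mulrn_eq0.
Qed.

Section HookIrreducible.
Variables (n : nat) (C : numFieldType) (p' : nat).
Hypothesis np : (p' < n)%N.
Local Notation I := 'I_n.
Implicit Types (w : seq I -> C) (g : I -> I -> C).
Local Notation tact g w := (@tensor_act n C C^o g w).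
Local Notation vext v w := (@ext_vec n C C^o v w).
Local Notation e := (@unit_vec n C).
Local Notation T := {ffun p'.+2.-tuple I -> C^o}.
Local Notation base := (first_letters n p').
Local Notation tl := (later_letters n p').
Local Notation hd := (first_letter np).
Local Notation W := (wedge (map e base)).

(** A zero row of g means that no image vector involves e_c. *)
Lemma tensor_act_row0 g w c s : (forall k, g c k = 0) -> c \in s -> tact g w s = 0.
Proof.
move=> gc; elim: s w => //= a s IH w; rewrite inE => /predU1P[<-|cs].
  by rewrite big1 // => k _; rewrite gc scale0r.
by rewrite big1 // => k _; rewrite IH ?scaler0.
Qed.

Lemma tensor_act_scale_row g w (x : C) s :
  tact (fun a k => (if a == hd then x else 1) * g a k) w s =
  x ^+ count_mem hd s * tact g w s.
Proof.
elim: s w => [|a s IH] w /=; first by rewrite mul1r.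
rewrite mulr_sumr; apply: eq_bigr => k _; rewrite IH exprD.
by rewrite /GRing.scale /=; case: (a == hd) => /=; rewrite ?expr1 ?expr0; ring.
Qed.

(** A word at which e_0 /\ ... /\ e_p' is nonzero is a permutation of the first
    p' + 1 letters and contains the letter 0 once. *)
Lemma first_letters_weight t a : size t = p'.+1 ->
  (if count_mem hd (a :: t) == 2%N then W t else 0) = (a == hd)%:R * W t.
Proof.
move=> tp; have [->|Wt] := eqVneq (W t) 0; first by rewrite mulr0 if_same.
have pt : perm_eq t base.
  by apply: wedge_unit_perm Wt; rewrite ?first_letters_uniq ?size_first_letters.
rewrite /= (permP pt) (first_letters_cons np) /= ?eqxx.
rewrite (count_memPn _); last by apply/negP => /(later_letters_neq np); rewrite eqxx.
by case: (a == hd); rewrite ?mul1r ?mul0r.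
Qed.

Section Stable.
Variable U : {vspace T}.
Hypothesis U_stable : forall g u, u \in U -> packed_act g u \in U.

(** By polarization u is nonzero at some (l, l, t) with l a linear form.  Take
    for g the matrix whose row 0 is l, whose next rows are the coordinate forms
    of t, and whose other rows are 0.  The image g w involves the first p
    letters only, so it is a vector times e_0 /\ ... /\ e_p'.  Scaling row 0 by T
    and extracting the coefficient of T^2 keeps the part of this vector along
    e_0, which is nonzero by the choice of g. *)
Lemma stable_highest_weight u : u \in U -> hook_tensor u -> u != 0 ->
  pack p'.+2 (symmetrize2 (highest_tensor C np)) \in U.
Proof.
move=> uU [w hw uE] u0.
have [a0 [b0 [t0 [tp wn0]]]] : exists a b t, size t = p' /\
    symmetrize2 w (a :: b :: t) != 0.
  have [s us] : exists s, u s != 0.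
    by apply/existsP; apply: contraNT u0 => /existsPn us; apply/eqP/ffunP => s;
       rewrite ffunE; apply/eqP; rewrite -[_ == _]negbK us.
  move: us; rewrite uE ffunE; case: s => -[|a [|b t]] //= tp us.
  by exists a, b, t; split => //; case/eqP: tp.
pose fm x y := symmetrize2 w (x :: y :: t0).
have [l ln0] : exists l : I -> C, \sum_x l x * (\sum_y l y * fm x y) != 0.
  by apply: (symmetric_form_neq0 (a := a0) (b := b0)) wn0 => x y; rewrite /fm /= addrC.
(* for 0 < a < p, row a of g is the coordinate form of the letter fr a *)
pose fr (a : I) := nth a0 t0 (val a).-1.
pose g a k : C := if a == hd then l k else if (a < p'.+1)%N then (k == fr a)%:R else 0.
pose w1 := tact g w.
have hw1 : tail_alternating w1 by apply: tensor_act_tail_alternating.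
have w1_0 a c s : c \notin base -> c \in s -> w1 (a :: s) = 0.
  move=> cb cs; apply: (@tensor_act_row0 _ _ c); last by rewrite inE cs orbT.
  move=> k; rewrite /g; have [ch|_] := eqVneq c hd.
    by rewrite ch mem_first_letters in cb.
  by move: cb; rewrite mem_first_letters // => /negbTE ->.
have w1E a t : size t = p'.+1 -> w1 (a :: t) = w1 (a :: base) * W t.
  move=> tq; apply: (alternating_top (w := fun s => w1 (a :: s))) => //.
  - exact: first_letters_uniq.
  - by rewrite size_first_letters.
  - by move=> c s; apply: w1_0.
pose gam := w1 (hd :: base).
have gam0 : gam != 0.
  have : symmetrize2 w1 (hd :: base) != 0.
    rewrite /w1 -tensor_act_symmetrize2 (first_letters_cons np) /=.
    suff E : \sum_k g hd k *: (\sum_l0 g hd l0 *: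
        tact g (fun r => symmetrize2 w (k :: l0 :: r)) tl) =
        \sum_x l x * (\sum_y l y * fm x y) by rewrite E.
    apply: eq_bigr => x _; rewrite /g eqxx; congr (_ * _).
    apply: eq_bigr => y _; congr (_ * _).
    rewrite (@tensor_act_rows n C C^o _ fr) ?(map_later_letters np a0 tp) // => a atl k.
    rewrite (later_letters_neq np atl) -(mem_first_letters np) (first_letters_cons np).
    by rewrite inE atl orbT.
  rewrite /gam (first_letters_cons np) /=.
  by apply: contraNneq => ->; rewrite addr0.
have wgt2 : pack p'.+2 (fun s => if count_mem hd s == 2%N then symmetrize2 w1 s else 0) \in U.
  apply: memv_dual => c cU.
  pose Q : {poly C} := \sum_(s : p'.+2.-tuple I)
     (c s * symmetrize2 w1 s) *: 'X^(count_mem hd s).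
  have QE x : Q.[x] = \sum_s c s *
      packed_act (fun a k => (if a == hd then x else 1) * g a k) u s.
    rewrite /Q horner_sum; apply: eq_bigr => s _; rewrite hornerZ hornerXn.
    rewrite uE packed_act_pack ffunE tensor_act_scale_row tensor_act_symmetrize2 /w1.
    by rewrite -mulrA; congr (_ * _); rewrite mulrC.
  have Q0 : Q = 0.
    apply: (@poly_eq0_generic _ 1) => [|x _]; first exact: oner_neq0.
    by rewrite QE; apply: cU; apply: U_stable.
  transitivity Q`_2; last by rewrite Q0 coef0.
  rewrite /Q coef_sum; apply: eq_bigr => s _; rewrite coefZ coefXn ffunE eq_sym.
  by case: eqP; rewrite ?mulr1 ?mulr0.
have vE : pack p'.+2 (symmetrize2 (highest_tensor C np)) =
    gam^-1 *: pack p'.+2 (fun s => if count_mem hd s == 2%N then symmetrize2 w1 s else 0).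
  apply/ffunP => s; rewrite !ffunE; apply: (mulfI gam0).
  rewrite /GRing.scale /= mulVKf //.
  case: s => -[|a [|b t]] //= tq; rewrite ?mulr0 ?if_same //.
  have tp1 : size t = p' by case/eqP: tq.
  have tp2 c : size (c :: t) = p'.+1 by rewrite /= tp1.
  rewrite (w1E a) // (w1E b) //.
  have Ea := first_letters_weight a (tp2 b); have Eb := first_letters_weight b (tp2 a).
  rewrite /= in Ea; rewrite /= addnCA in Eb; rewrite /unit_vec -Ea -Eb.
  case: eqP => cnt; last by rewrite addr0 mulr0.
  rewrite cnt eqxx in Ea; rewrite cnt eqxx in Eb.
  rewrite mulrDr; congr (_ + _).
    have [->|ah] := eqVneq a hd; first by [].
    by rewrite Ea (negbTE ah) mul0r !mulr0.
  have [->|bh] := eqVneq b hd; first by [].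
  by rewrite Eb (negbTE bh) mul0r !mulr0.
by rewrite vE memvZ.
Qed.

End Stable.
End HookIrreducible.

(** * The hook module *)

(** A subspace of maximal dimension among those that satisfy P. *)
Lemma vspace_of_closed (K : fieldType) (vT : vectType K) (P : vT -> Prop) :
  P 0 -> (forall c u v, P u -> P v -> P (c *: u + v)) ->
  exists U : {vspace vT}, forall u, u \in U <-> P u.
Proof.
move=> P0 PL.
pose Q k := `[< exists2 U : {vspace vT}, \dim U = k & forall u, u \in U -> P u >].
have exQ : exists k, Q k.
  exists 0%N; apply/asboolP; exists 0%VS; first by rewrite dimv0.
  by move=> u; rewrite memv0 => /eqP ->.
have bQ k : Q k -> (k <= \dim {:vT})%N.
  by move=> /asboolP[U <- _]; apply/dimvS/subvf.
case: (ex_maxnP exQ bQ) => k /asboolP[U Uk UP] kmax.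
exists U => u; split; first exact: UP.
move=> Pu; apply: contraT => uU.
have : Q (\dim (U + <[u]>)%VS).
  apply/asboolP; exists (U + <[u]>)%VS => // v /memv_addP[x xU [y /vlineP[c ->] ->]].
  by rewrite addrC; apply: PL => //; apply: UP.
move/kmax; rewrite -Uk => dU.
have /eqP UE : U == (U + <[u]>)%VS by rewrite eqEdim addvSl.
case/negP: uU; rewrite UE; apply: (subvP (addvSr _ _)); exact: memv_line.
Qed.

Lemma span_take (K : fieldType) (vT : vectType K) (s : seq vT) j u :
  (j <= size s)%N -> u \in <<take j s>>%VS ->
  exists c : nat -> K, u = \sum_(i < j) c i *: s`_i.
Proof.
elim: j u => [|j IH] u js.
  rewrite take0 span_nil memv0 => /eqP ->; exists (fun=> 0).
  by rewrite big_ord0.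
rewrite (take_nth 0) // -cats1 span_cat span_seq1.
case/memv_addP => x /(IH _ (ltnW js))[c ->] [y /vlineP[k ->] ->].
exists (fun i => if (i < j)%N then c i else k).
rewrite big_ord_recr /= ltnn; congr (_ + _).
by apply: eq_bigr => i _; rewrite ltn_ord.
Qed.

Section Coordinates.
Variables (R : realType) (V : vectType R[i]).
Local Notation n := (\dim {:V}).
Local Notation C := R[i].
Local Notation I := 'I_n.
Local Notation b := (vbasis {:V}).

Definition end_mx (g : 'End(V)) (a k : I) : C := coord b a (g b`_k).

Lemma end_mx1 a k : end_mx \1%VF a k = (k == a)%:R.
Proof. by rewrite /end_mx id_lfunE coord_free ?(basis_free (vbasisP _)). Qed.

Lemma end_mx_coord g v a :
  \sum_k end_mx g a k * coord b k v = coord b a (g v).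
Proof.
rewrite [in RHS](coord_vbasis (memvf v)) linear_sum linear_sum.
by apply: eq_bigr => k _; rewrite !linearZ /= mulrC.
Qed.

Lemma end_mxM g h a k :
  end_mx (g \o h)%VF a k = \sum_l end_mx g a l * end_mx h l k.
Proof. by rewrite [RHS]end_mx_coord /end_mx comp_lfunE. Qed.

Definition mx_end (A : 'M[C]_n) : 'End(V) :=
  linfun (fun v => \sum_i (\sum_k A i k * coord b k v) *: b`_i).

Lemma mx_endE A v : mx_end A v = \sum_i (\sum_k A i k * coord b k v) *: b`_i.
Proof.
have L : linear (fun v => \sum_i (\sum_k A i k * coord b k v) *: b`_i).
  move=> c u x; rewrite scaler_sumr -big_split; apply: eq_bigr => i _ /=.
  rewrite scalerA -scalerDl; congr (_ *: _).
  rewrite mulr_sumr -big_split; apply: eq_bigr => k _ /=.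
  by rewrite linearP mulrDr mulrCA.
pose f : {linear V -> V} := HB.pack (fun v => \sum_i (\sum_k A i k * coord b k v) *: b`_i)
  (GRing.isLinear.Build _ _ _ _ _ L).
exact: (lfunE f).
Qed.

Lemma end_mxK A a k : end_mx (mx_end A) a k = A a k.
Proof.
have bf := basis_free (vbasisP {:V}).
have colE i : \sum_l A i l * coord b l b`_k = A i k.
  rewrite (bigD1 k) //= coord_free // eqxx mulr1 big1 ?addr0 // => l lk.
  by rewrite coord_free // eq_sym (negbTE lk) mulr0.
rewrite /end_mx mx_endE; under eq_bigr do rewrite colE.
rewrite linear_sum (bigD1 a) //= big1 ?addr0 => [|i ia].
  by rewrite linearZ /= coord_free // eqxx mulr1.
by rewrite linearZ /= coord_free // (negbTE ia) mulr0.
Qed.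

(** A vector in the kernel has its coordinate column killed by A. *)
Lemma mx_end_GL A : A \in unitmx -> is_GL (mx_end A).
Proof.
move=> uA; rewrite /is_GL -subv0; apply/subvP => v; rewrite memv_ker memv0 => /eqP Av.
have cv a : \sum_k A a k * coord b k v = 0.
  by under eq_bigr do rewrite -end_mxK; rewrite end_mx_coord Av linear0.
pose x : 'cV[C]_n := \col_k coord b k v.
have Ax : A *m x = 0.
  by apply/matrixP => i j; rewrite !mxE -[RHS](cv i); apply: eq_bigr => k _; rewrite mxE.
have x0 : x = 0 by rewrite -[x](mulKmx uA) Ax mulmx0.
rewrite (coord_vbasis (memvf v)) big1 // => k _.
by have := congr1 (fun y : 'cV[C]_n => y k 0) x0; rewrite !mxE => ->; rewrite scale0r.
Qed.

End Coordinates.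

Section HookModule.
Variables (R : realType) (V : vectType R[i]) (p' : nat).
Local Notation n := (\dim {:V}).
Local Notation C := R[i].
Local Notation I := 'I_n.
Local Notation b := (vbasis {:V}).
Local Notation T := {ffun p'.+2.-tuple I -> C^o}.
Variable H : {vspace T}.
Hypothesis HE : forall u, u \in H <-> hook_tensor u.

Lemma packed_act_H g u : u \in H -> packed_act g u \in H.
Proof. by move=> /HE uH; apply/HE; apply: packed_act_hook_tensor. Qed.

Definition hook_act_fun (g : 'End(V)) (m : subvs_of H) : subvs_of H :=
  vsproj H (packed_act (end_mx g) (vsval m)).

Fact hook_act_linear g : linear (hook_act_fun g).
Proof. by move=> c u v; rewrite /hook_act_fun !linearP. Qed.

HB.instance Definition _ g := GRing.isLinear.Build C (subvs_of H) (subvs_of H) *:%R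
  (hook_act_fun g) (hook_act_linear g).

Definition hook_act (g : 'End(V)) : 'End(subvs_of H) := linfun (hook_act_fun g).

Lemma hook_actE g m : vsval (hook_act g m) = packed_act (end_mx g) (vsval m).
Proof. by rewrite lfunE vsprojK // packed_act_H // subvsP. Qed.

Fact hook_act1 : hook_act \1%VF = \1%VF.
Proof.
apply/lfunP => m; apply: val_inj; rewrite /= hook_actE id_lfunE.
by rewrite (eq_packed_act (h := fun a k => (k == a)%:R)) ?packed_act1 // => a k; apply: end_mx1.
Qed.

Fact hook_actM g h : is_GL g -> is_GL h ->
  hook_act (g \o h)%VF = (hook_act g \o hook_act h)%VF.
Proof.
move=> _ _; apply/lfunP => m; apply: val_inj; rewrite /= comp_lfunE !hook_actE packed_act_comp.
by apply: eq_packed_act => a k; apply: end_mxM.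
Qed.

Definition hook_module : GL_module V := GLModule hook_act1 hook_actM.

(** Run the action with the variables as matrix entries and evaluate. *)
Lemma hook_module_polynomial : GL_polynomial hook_module.
Proof.
move=> w k.
pose del s : T := [ffun r => (r == s)%:R].
pose c s : C := coord (vbasis {:subvs_of H}) k (vsproj H (del s)).
pose X a l : {mpoly C[n * n]} := 'X_(mxvec_index a l).
pose W (r : seq I) : {mpoly C[n * n]}^o := (unpack (vsval w) r)%:MP.
exists (\sum_(s : p'.+2.-tuple I) c s *: (tensor_act X W s : {mpoly C[n * n]})) => g _.
rewrite raddf_sum /=.
have -> : GL_act hook_module g w =
    \sum_s packed_act (end_mx g) (vsval w) s *: vsproj H (del s).
  rewrite /= lfunE /= /hook_act_fun; set y := packed_act _ _.
  have -> : y = \sum_s y s *: del s.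
    apply/ffunP => i; rewrite sum_ffunE (bigD1 i) //= !ffunE eqxx.
    rewrite big1 => [|j ji]; first by rewrite addr0 /GRing.scale /= mulr1.
    by rewrite !ffunE eq_sym (negbTE ji) scaler0.
  rewrite linear_sum; apply: eq_bigr => s _; rewrite linearZ; congr (_ *: _).
  by rewrite sum_ffunE (bigD1 s) //= !ffunE eqxx big1 ?addr0 => [|j ji];
     rewrite ?ffunE /GRing.scale /= ?mulr1 // eq_sym (negbTE ji) mulr0.
rewrite linear_sum; apply: eq_bigr => s _; rewrite linearZ /= mevalZ mulrC ffunE.
congr (_ * _); set ev := (X in _ = _.@[X]).
have hD : {morph (fun p : {mpoly C[n * n]}^o => p.@[ev] : C^o) : p q / p + q}.
  by move=> p q; apply: mevalD.
have hZ (p : {mpoly C[n * n]}) (q : {mpoly C[n * n]}^o) :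
  ((p *: q).@[ev] : C^o) = p.@[ev] *: (q.@[ev] : C^o) by exact: mevalM.
rewrite (tensor_act_map W s hD (meval0 _) (fun a l => hZ (X a l))).
under [RHS]eq_tensor_act do rewrite /W mevalC.
apply: (@eq_tensor_act_mx n C C^o) => a l.
by rewrite /X mevalXU /ev mxvecE mxE.
Qed.

Lemma hook_module_zero : (n < p'.+1)%N -> \dim {:hook_module} = 0%N.
Proof.
move=> np; apply/eqP; rewrite dimv_eq0 -subv0; apply/subvP => m _.
rewrite memv0; apply/eqP; apply: val_inj => /=.
by apply: (hook_tensor_eq0 np); apply/HE; apply: subvsP.
Qed.

Section Nonzero.
Hypothesis np : (p' < n)%N.

(** The symmetrization of v_0 (x) (v_0 /\ ... /\ v_p'). *)
Definition decomposable (v : nat -> I -> C) : T :=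
  pack p'.+2 (symmetrize2 (pure (v 0%N) (wedge (mkseq v p'.+1)))).

Lemma highest_tensor_decomposable :
  pack p'.+2 (symmetrize2 (highest_tensor C np)) =
  decomposable (fun j a => (val a == j)%:R).
Proof.
rewrite /decomposable /highest_tensor; congr (pack _ (symmetrize2 (pure _ (wedge _)))).
rewrite /mkseq -(val_first_letters np) -map_comp; apply: eq_map => k; apply: funext => a.
by rewrite /unit_vec /=.
Qed.

Lemma eq_decomposable v v' :
  (forall j a, (j < p'.+1)%N -> v j a = v' j a) -> decomposable v = decomposable v'.
Proof.
move=> vv'; rewrite /decomposable.
rewrite (_ : v 0%N = v' 0%N); last by apply: funext => a; apply: vv'.
rewrite (_ : mkseq v p'.+1 = mkseq v' p'.+1) //.
apply/eq_in_map => j; rewrite mem_iota => jp.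
by apply: funext => a; apply: vv'.
Qed.

Lemma packed_act_decomposable g v :
  packed_act g (decomposable v) = decomposable (fun j a => \sum_k g a k * v j k).
Proof.
rewrite packed_act_pack; apply: eq_pack => s _; rewrite tensor_act_symmetrize2.
congr symmetrize2; apply: funext => r; rewrite tensor_act_pure.
congr pure; apply: funext => q; rewrite tensor_act_wedge.
by rewrite /mkseq -map_comp.
Qed.

Lemma decomposable_H v : decomposable v \in H.
Proof.
apply/HE; exists (pure (v 0%N) (wedge (mkseq v p'.+1))) => //.
exact: pure_wedge_tail_alternating.
Qed.

Lemma highest_tensor_neq0 : pack p'.+2 (symmetrize2 (highest_tensor C np)) != 0.
Proof.
have ts : size (first_letter np :: first_letters n p') == p'.+2 by rewrite /= size_first_letters.
apply/eqP => /ffunP /(_ (Tuple ts)); rewrite !ffunE /=.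
rewrite /highest_tensor; set W := wedge _.
have W1 : W (first_letters n p') = 1 by apply: wedge_unit_self; apply: first_letters_uniq.
rewrite (first_letters_cons np) /= -(first_letters_cons np) W1 /unit_vec eqxx mulr1 => /eqP.
by rewrite -mulr2n pnatr_eq0.
Qed.

(** A linear map taking the basis w to the reference basis takes the vector to
    the one attached to the reference basis. *)
Lemma decomposable_neq0 (w : (\dim {:V}).-tuple V) : basis_of {:V} w ->
  decomposable (fun j a => coord b a w`_j) != 0.
Proof.
move=> wb; have wf := basis_free wb.
pose A : 'M[C]_n := \matrix_(i, k) coord w i b`_k.
have AE v i : \sum_k A i k * coord b k v = coord w i v.
  rewrite [in RHS](coord_vbasis (memvf v)) linear_sum; apply: eq_bigr => k _.
  by rewrite mxE linearZ /= mulrC.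
apply: contraNneq highest_tensor_neq0 => /(congr1 (packed_act (fun i k => A i k))).
rewrite linear0 packed_act_decomposable => h0; apply/eqP.
rewrite highest_tensor_decomposable -[RHS]h0; apply: eq_decomposable => j a jp.
rewrite AE; have jn : (j < n)%N by apply: leq_trans jp np.
by rewrite -[j]/(val (Ordinal jn)) coord_free // eq_sym.
Qed.

Lemma highest_weight_prod (d : nat -> C) :
  d 0%N * \prod_(0 <= k < p'.+1) d k =
  \prod_(j < n) d j ^+ nth 0%N (2%N :: nseq p' 1%N) j.
Proof.
rewrite -(big_mkord xpredT (fun j => d j ^+ nth 0%N (2%N :: nseq p' 1%N) j)).
(* the exponents vanish from p' + 1 on, and the exponent of d 0 is 2 *)
rewrite [RHS](big_cat_nat (n := p'.+1)) //= [X in _ = _ * X]big_nat_cond [X in _ = _ * X]big1 => [|j].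
  rewrite mulr1 !big_nat_recl //= mulrA -expr2; congr (_ * _).
  rewrite big_nat_cond [RHS]big_nat_cond; apply: eq_bigr => j /andP[/andP[_ jp] _].
  by rewrite nth_nseq jp expr1.
rewrite andbT; case: j => // j /andP[pj _] /=.
by rewrite nth_nseq ltnNge -ltnS pj expr0.
Qed.

(** For an upper triangular g the lower terms of the g v_j cancel in the exterior
    product; the weight t_0 * (t_0 ... t_p') has t_0 twice. *)
Lemma hook_module_highest_weight :
  GL_highest_weight hook_module (2%N :: nseq p' 1%N).
Proof.
move=> w wb; pose v j a := coord b a w`_j.
have sw : size w = n by rewrite size_tuple.
exists (vsproj H (decomposable v) : hook_module).
  apply: contraNneq (decomposable_neq0 wb) => h0.
  by rewrite -(vsprojK (decomposable_H v)) h0.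
move=> g t _ gt; apply: val_inj; rewrite /= hook_actE vsprojK ?decomposable_H //.
pose d k := if insub k is Some i then t i else 0.
have dE (j : I) : d j = t j by rewrite /d valK.
have /boolp.choice[c cE] k : exists ck : nat -> C, (k < n)%N ->
    g w`_k = d k *: w`_k + \sum_(i < k) ck i *: w`_i.
  have [kn|kn] := ltnP k n; last by exists (fun=> 0).
  have := gt (Ordinal kn); rewrite -dE /= => gk.
  have [|ck E] := span_take _ gk; first by rewrite sw ltnW.
  by exists ck => _; rewrite -E addrC subrK.
have gvE k a : (k < n)%N ->
    \sum_l end_mx g a l * v k l = d k * v k a + \sum_(i < k) c k i * v i a.
  move=> kn; rewrite /v end_mx_coord cE // linearD linearZ linear_sum.
  by congr (_ + _); apply: eq_bigr => i _; rewrite linearZ.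
under eq_bigr do rewrite -dE.
rewrite -highest_weight_prod packed_act_decomposable.
apply/ffunP => s; rewrite !ffunE.
have W s' : wedge (mkseq (fun k a => \sum_l end_mx g a l * v k l) p'.+1) s' =
    \prod_(0 <= k < p'.+1) d k * wedge (mkseq v p'.+1) s'.
  apply: (@ext_vecs_triangular n C C^o (@two_free_num C) v _ d c 0 p'.+1).
  by move=> k a /= kp; apply: gvE; apply: leq_trans kp np.
move: W; move: (wedge _) (wedge _) => W1 W2 W.
have g0 a : \sum_l end_mx g a l * v 0%N l = d 0%N * v 0%N a.
  by rewrite gvE ?big_ord0 ?addr0 // (leq_ltn_trans _ np).
case: (tval s) => [|a [|a' r]] /=; rewrite ?scaler0 //.
by rewrite !W !g0 /GRing.scale /=; ring.
Qed.

Lemma hook_module_irreducible : GL_irreducible hook_module.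
Proof.
split.
  rewrite dimv_eq0; apply: contraNneq highest_tensor_neq0 => M0.
  have vH : pack p'.+2 (symmetrize2 (highest_tensor C np)) \in H.
    by rewrite highest_tensor_decomposable decomposable_H.
  have : vsproj H (pack p'.+2 (symmetrize2 (highest_tensor C np)))
      \in {:hook_module}%VS by apply: memvf.
  rewrite M0 memv0 => /eqP h0; apply/eqP.
  by rewrite -(vsprojK vH) h0.
move=> U Ug.
have [->|U0] := eqVneq U 0%VS; [by left | right].
pose f : 'Hom(subvs_of H, T) := linfun vsval.
pose U' := (f @: U)%VS.
have fE m : f m = vsval m by rewrite lfunE.
have U'st g u : u \in U' -> packed_act g u \in U'.
  apply: packed_act_stable => A uA x /memv_imgP[m mU ->].
  have := Ug _ (mx_end_GL uA) => /subvP /(_ (hook_act (mx_end A) m)).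
  rewrite memv_img // => /(_ isT) mU'.
  apply/memv_imgP; exists (hook_act (mx_end A) m) => //.
  rewrite !fE hook_actE; apply: eq_packed_act => a k; by rewrite end_mxK.
have fH m : hook_tensor (f m) by apply/HE; rewrite fE subvsP.
have highU' : pack p'.+2 (symmetrize2 (highest_tensor C np)) \in U'.
  apply: (stable_highest_weight np U'st (memv_img f (memv_pick U))).
  - exact: fH.
  - rewrite fE; apply: contraNneq U0 => h0; rewrite -vpick0; apply/eqP.
    exact: val_inj.
apply/eqP; rewrite eqEsubv subvf; apply/subvP => m _.
have [w hw mE] := fH m.
have : f m \in U' by rewrite mE; apply: stable_generation highU' _ _.
case/memv_imgP => m' m'U; rewrite !fE => /val_inj ->; exact: m'U.
Qed.

End Nonzero.

Theorem hook_module_is_pi : is_pi (2%N :: nseq p' 1%N) hook_module.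
Proof.
rewrite /is_pi /= size_nseq; case: ltnP => np; last exact: hook_module_zero.
split; [exact: hook_module_polynomial|exact: hook_module_irreducible|].
exact: hook_module_highest_weight.
Qed.

End HookModule.

(** * The symmetric algebra modulo quadrics *)

Section LowDegree.
Variables (R : realType) (V : vectType R[i]).
Local Notation n := (\dim {:V}).
Local Notation C := R[i].
Local Notation I := 'I_n.
Local Notation S := (Sym V).
Local Notation A := (quadric_quotient V).

Definition sym_coeff (m : 'X_{1..n}) (f : S) : C := (f : {mpoly C[n]})@_m.

Fact sym_coeff_additive m : additive (sym_coeff m).
Proof. exact: mcoeffB. Qed.

HB.instance Definition _ m := GRing.isAdditive.Build S C (sym_coeff m) (sym_coeff_additive m).

Lemma sym_coeffD m f h : sym_coeff m (f + h) = sym_coeff m f + sym_coeff m h.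
Proof. exact: mcoeffD. Qed.

Lemma sym_coeffN m f : sym_coeff m (- f) = - sym_coeff m f.
Proof. exact: mcoeffN. Qed.

Lemma sym_coeff0 m : sym_coeff m 0 = 0.
Proof. exact: mcoeff0. Qed.

Definition sym_var (k : I) : S := ('X_k : {mpoly C[n]}).

Fact to_quotient_additive : additive (@to_quotient R V).
Proof. by move=> f g; exact: raddfB. Qed.

HB.instance Definition _ := GRing.isAdditive.Build S A (@to_quotient R V) to_quotient_additive.

Lemma to_quotientM f g : to_quotient (f * g) = to_quotient f * to_quotient g :> A.
Proof. exact: rmorphM. Qed.

Lemma to_quotientD f g : to_quotient (f + g) = to_quotient f + to_quotient g :> A.
Proof. exact: raddfD. Qed.

Lemma to_quotientN f : to_quotient (- f) = - to_quotient f :> A.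
Proof. exact: raddfN. Qed.

Lemma to_quotient0 : to_quotient (0 : S) = 0 :> A.
Proof. exact: raddf0. Qed.

Lemma to_quotient_surj (a : A) : exists f, to_quotient f = a.
Proof. by exists (repr a); apply: reprK. Qed.

(** The ideal is m^2: every monomial of degree at least 2 has a quadratic
    factor. *)
Lemma quadric_ideal_coeff (f : S) :
  quadric_ideal f <-> forall m, (mdeg m < 2)%N -> sym_coeff m f = 0.
Proof.
split=> [/asboolP[s [hs ->]] m m2|f0].
  rewrite raddf_sum big_seq big1 // => am /hs hom.
  change ((((am.1 : S) : {mpoly C[n]}) * ((am.2 : S) : {mpoly C[n]}))@_m = 0).
  rewrite mcoeffM big1 // => k /eqP mE.
  rewrite (dhomog_nemf_coeff hom) ?mul0r // neq_ltn.
  apply/orP; left; apply: leq_ltn_trans m2.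
  by have := congr1 mdeg mE; rewrite mdegD => E; rewrite [X in (_ <= X)%N]E leq_addr.
apply/asboolP.
have ideal0 : smul_span (fun a : S => sym_homog 2 a) (0 : (Sym V)^o).
  by exists [::]; rewrite big_nil.
have idealD (x y : (Sym V)^o) : smul_span (fun a : S => sym_homog 2 a) x ->
    smul_span (fun a : S => sym_homog 2 a) y ->
    smul_span (fun a : S => sym_homog 2 a) (x + y).
  move=> [s [hs ->]] [t [ht ->]]; exists (s ++ t); rewrite big_cat; split=> // am.
  by rewrite mem_cat => /orP[/hs|/ht].
have -> : f = \sum_(m <- msupp (f : {mpoly C[n]})) ((f : {mpoly C[n]})@_m *: 'X_[m] : {mpoly C[n]}).
  exact: mpolyE.
rewrite big_seq; apply: big_ind => // m mf.
have m2 : (2 <= mdeg m)%N.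
  rewrite leqNgt; apply/negP => /f0 fm.
  by move: mf; rewrite mcoeff_msupp /= -/(sym_coeff m f) fm eqxx.
have [i mi] : exists i, (0 < m i)%N.
  apply/existsP; apply: contraTT m2 => /existsPn m0.
  by rewrite mdegE big1 // => i _; apply/eqP; rewrite -leqn0 leqNgt m0.
have im : (U_(i) <= m)%MM by rewrite lep1mP -lt0n.
have [j mj] : exists j, (0 < (m - U_(i))%MM j)%N.
  apply/existsP; apply: contraTT m2 => /existsPn m0.
  rewrite -(submK im) mdegD mdeg1 mdegE big1 // => k _.
  by apply/eqP; rewrite -leqn0 leqNgt m0.
have jm : (U_(j) <= m - U_(i))%MM by rewrite lep1mP -lt0n.
pose g : S := ('X_[U_(j) + U_(i)] : {mpoly C[n]}).
pose h : S := ((f : {mpoly C[n]})@_m *: 'X_[m - U_(i) - U_(j)] : {mpoly C[n]}).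
exists [:: (g, h)]; split=> [am|].
  by rewrite inE => /eqP -> /=; rewrite /sym_homog dhomogX /= mdegD !mdeg1.
rewrite big_seq1 /= /g /h /GRing.scale /= -scalerAr -mpolyXD addmC addmA.
by rewrite submK // submK.
Qed.

Lemma to_quotient_eq (f g : S) :
  to_quotient f = to_quotient g :> A <->
  forall m, (mdeg m < 2)%N -> sym_coeff m f = sym_coeff m g.
Proof.
have E : to_quotient f = to_quotient g :> A <-> to_quotient (f - g) = 0 :> A.
  have -> : to_quotient (f - g) = to_quotient f - to_quotient g :> A by exact: raddfB.
  split=> [->|/eqP]; first by rewrite subrr.
  by rewrite subr_eq0 => /eqP.
rewrite E to_quotient_eq0 quadric_ideal_coeff.
split=> H m /H; rewrite raddfB; first by move/eqP; rewrite subr_eq0 => /eqP.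
by move/eqP; rewrite -subr_eq0 => /eqP.
Qed.

Lemma two_free_sym (M : lmodType S) : two_free M.
Proof.
have half : sym_scalar V 2^-1 * 2%:R = 1 :> S.
  rewrite mulr_natr; transitivity ((2^-1 *+ 2)%:MP_[n] : S); first exact/esym/raddfMn.
  have -> : (2^-1 : C) *+ 2 = 1 by rewrite -[LHS]mulr_natr mulVf ?pnatr_eq0.
  by [].
move=> m; rewrite -mulr2n -scaler_nat => m0.
by rewrite -[m]scale1r -half -scalerA m0 scaler0.
Qed.

Lemma two_free_quotient : two_free A.
Proof.
move=> a; have [f <-] := to_quotient_surj a; move=> ff0.
have ff : to_quotient (f + f) = to_quotient 0 :> A.
  by rewrite raddfD raddf0; exact: ff0.
rewrite -[RHS](raddf0 (@to_quotient R V)); apply/to_quotient_eq => m m2.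
have := (to_quotient_eq (f + f) 0).1 ff m m2.
rewrite (raddfD (sym_coeff m)) (raddf0 (sym_coeff m)) => /eqP.
rewrite -mulr2n mulrn_eq0 => /eqP E.
exact: E.
Qed.

Lemma koszul_exact_sym : @koszul_exact n S sym_var (S^o : lmodType S).
Proof. exact: koszul_exact_mpoly. Qed.

Lemma sym_homog_var k : sym_homog 1 (sym_var k).
Proof. by rewrite /sym_homog dhomogX /= mdeg1. Qed.

Lemma sym_coeff0_koszul (v : seq I -> S) t :
  sym_coeff 0%MM (koszul sym_var (v : seq I -> S^o) t) = 0.
Proof.
rewrite raddf_sum big1 // => k _.
change (((sym_var k : {mpoly C[n]}) * (v (k :: t) : {mpoly C[n]}))@_0%MM = 0).
by rewrite (rmorphM (mcoeff 0%MM)) /= mcoeffX mnm1_eq0 mul0r.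
Qed.

(** The linear part of sum_k X_k v_k is given by the constant terms of the v_k;
    thus the Koszul differential of A is the inclusion of /\^(p+1) V in
    V (x) /\^p V. *)
Lemma sym_coeff1_koszul (v : seq I -> S) a t :
  sym_coeff U_(a)%MM (koszul sym_var (v : seq I -> S^o) t) = sym_coeff 0%MM (v (a :: t)).
Proof.
rewrite raddf_sum (bigD1 a) //= big1 ?addr0 => [|k ka].
  change (((sym_var a : {mpoly C[n]}) * (v (a :: t) : {mpoly C[n]}))@_U_(a) =
    sym_coeff 0%MM (v (a :: t))).
  by rewrite mulrC -[X in _@_X]addm0 mcoeffMX.
change (((sym_var k : {mpoly C[n]}) * (v (k :: t) : {mpoly C[n]}))@_U_(a) = 0).
apply: memN_msupp_eq0; rewrite mulrC (perm_mem (msuppMX _ _)).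
apply/mapP => -[m _ E]; move: ka; have := congr1 (fun m : 'X_{1..n} => m k) E.
by rewrite mnmDE !mnm1E eqxx eq_sym; case: eqP.
Qed.

Lemma mdeg_lt2 (m : 'X_{1..n}) : (mdeg m < 2)%N -> m = 0%MM \/ exists a, m = U_(a)%MM.
Proof.
case E : (mdeg m) => [|[|//]] _; first by left; apply/eqP; rewrite -mdeg_eq0 E.
right; have /mdeg1P[a /eqP ->] : mdeg m == 1%N by rewrite E.
by exists a.
Qed.

End LowDegree.

(** * Gradings and zigzags *)

Section Component.
Variables (R : realType) (V : vectType R[i]) (M : lmodType (Sym V)).
Variables (D : int -> M -> Prop) (gD : is_grading D).

Lemma grading0 q : D q 0. Proof. exact: (gradingB gD q).1. Qed.

Lemma gradingN q x : D q x -> D q (- x).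
Proof. by move=> Dx; rewrite -sub0r; apply: (gradingB gD q).2 => //; apply: grading0. Qed.

Lemma gradingD q x y : D q x -> D q y -> D q (x + y).
Proof. by move=> Dx /gradingN Dy; rewrite -[y]opprK; apply: (gradingB gD q).2. Qed.

(** A degree may be listed several times, so that decompositions are added by
    concatenation. *)
Definition off_degree (q : int) (x : M) : Prop := exists s : seq (int * M),
  (forall a, a \in s -> a.1 != q /\ D a.1 a.2) /\ x = \sum_(a <- s) a.2.

Lemma off_degreeD q x y : off_degree q x -> off_degree q y -> off_degree q (x + y).
Proof.
move=> [s [hs ->]] [t [ht ->]]; exists (s ++ t); rewrite big_cat; split=> // a.
by rewrite mem_cat => /orP[/hs|/ht].
Qed.

Lemma off_degreeN q x : off_degree q x -> off_degree q (- x).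
Proof.
move=> [s [hs ->]]; exists [seq (a.1, - a.2) | a <- s]; split.
  by move=> _ /mapP[a /hs[aq Da] ->]; split=> //; apply: gradingN.
by rewrite big_map -sumrN.
Qed.

Lemma off_degreeZ k q (f : Sym V) x :
  sym_homog k f -> off_degree q x -> off_degree (q + k%:Z) (f *: x).
Proof.
move=> hf [s [hs ->]]; exists [seq (a.1 + k%:Z, f *: a.2) | a <- s]; split.
  move=> _ /mapP[a /hs[aq Da] ->]; split; last exact: gradingZ.
  by rewrite (inj_eq (addIr _)).
by rewrite big_map scaler_sumr.
Qed.

(** The summands of x are grouped by degree, because a decomposition may list a
    degree several times, before directness applies. *)
Lemma off_degree_eq0 q x : D q x -> off_degree q x -> x = 0.
Proof.
move=> Dx [s [hs xE]].
pose d := undup [seq a.1 | a <- s].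
pose c r := if r == q then - x else \sum_(a <- s | a.1 == r) a.2.
have cD r : D r (c r).
  rewrite /c; case: eqP => [->|/eqP rq]; first exact: gradingN.
  rewrite big_seq_cond; apply: big_ind; [exact: grading0|exact: gradingD|].
  by move=> a /andP[/hs[_ Da] /eqP <-].
have qd : q \notin d.
  by rewrite mem_undup; apply/mapP => -[a /hs[aq _] qa]; rewrite qa eqxx in aq.
have xs : x = \sum_(r <- d) c r.
  rewrite [LHS]xE big_seq (eq_bigr (fun a => \sum_(r <- d | r == a.1) a.2)).
    rewrite (exchange_big_dep xpredT) //= [RHS]big_seq [LHS]big_seq.
    apply: eq_bigr => r rd; rewrite /c; case: eqP => [rq|_].
      by rewrite rq (negbTE qd) in rd.
    rewrite [RHS]big_seq_cond; apply: eq_bigl => a; by rewrite eq_sym.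
  move=> a as_; rewrite -big_filter.
  have ad : a.1 \in d by rewrite mem_undup map_f.
  by rewrite filter_pred1_uniq ?undup_uniq // big_seq1.
have cq : c q = - x by rewrite /c eqxx.
have ud : uniq (q :: d) by rewrite /= qd undup_uniq.
have s0 : \sum_(r <- q :: d) c r = 0 by rewrite big_cons -xs cq addNr.
have := grading_direct gD ud cD s0 (mem_head q d).
by rewrite cq => /eqP; rewrite oppr_eq0 => /eqP.
Qed.

Lemma component_exists q x : exists y, D q y /\ off_degree q (x - y).
Proof.
have [s [c [cD ->]]] := grading_sum gD x.
exists (\sum_(r <- s | r == q) c r); split.
  by apply: big_ind; [exact: grading0|exact: gradingD|move=> r /eqP <-].
exists [seq (r, c r) | r <- s & r != q]; split.
  by move=> a /mapP[r]; rewrite mem_filter => /andP[rq _] ->.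
rewrite big_map big_filter /= (bigID (fun r => r == q)) /=.
by rewrite addrAC subrr add0r.
Qed.

Definition component q x : M := projT1 (cid (component_exists q x)).

Lemma componentP q x : D q (component q x).
Proof. by rewrite /component; case: cid => y []. Qed.

Lemma component_off q x : off_degree q (x - component q x).
Proof. by rewrite /component; case: cid => y []. Qed.

Lemma component_eq q x y : D q y -> off_degree q (x - y) -> component q x = y.
Proof.
move=> Dy oy; apply/eqP; rewrite -subr_eq0; apply/eqP.
apply: (@off_degree_eq0 q); first by apply: (gradingB gD q).2 => //; apply: componentP.
rewrite -[component q x - y](_ : (x - y) - (x - component q x) = _).
  by apply: off_degreeD => //; apply/off_degreeN/component_off.
by rewrite opprB addrC addrA addrNK.
Qed.

Lemma component_id q x : D q x -> component q x = x.
Proof.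
move=> Dx; apply: component_eq => //; rewrite subrr.
by exists [::]; rewrite big_nil.
Qed.

Fact component_additive q : additive (component q).
Proof.
move=> x y; apply: component_eq.
  by apply: (gradingB gD q).2; apply: componentP.
have -> : x - y - (component q x - component q y) =
    (x - component q x) + - (y - component q y).
  by rewrite !opprB [component q y - _]addrC addrACA [- y + _]addrC.
by apply: off_degreeD; [|apply: off_degreeN]; apply: component_off.
Qed.

HB.instance Definition _ q := GRing.isAdditive.Build M M (component q) (component_additive q).

Lemma componentZ k q (f : Sym V) x : sym_homog k f ->
  component (q + k%:Z) (f *: x) = f *: component q x.
Proof.
move=> hf; apply: component_eq; first by apply: gradingZ => //; apply: componentP.
by rewrite -scalerBr; apply: off_degreeZ => //; apply: component_off.
Qed.

End Component.

Lemma component_map (R : realType) (V : vectType R[i]) (M N : lmodType (Sym V))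
    (D : int -> M -> Prop) (E : int -> N -> Prop)
    (gD : is_grading D) (gE : is_grading E) (f : {additive M -> N}) :
  (forall q x, D q x -> E q (f x)) ->
  forall q x, component gE q (f x) = f (component gD q x).
Proof.
move=> fD q x; apply: component_eq; first by apply: fD; apply: componentP.
rewrite -raddfB; have [s [hs ->]] := component_off gD q x.
exists [seq (a.1, f a.2) | a <- s]; split.
  by move=> _ /mapP[a /hs[aq Da] ->]; split=> //; apply: fD.
by rewrite big_map raddf_sum.
Qed.

Section Zigzag.
Variables (R : realType) (V : vectType R[i]) (F : graded_resolution V).
Local Notation n := (\dim {:V}).
Local Notation C := R[i].
Local Notation I := 'I_n.
Local Notation S := (Sym V).
Local Notation A := (quadric_quotient V).
Local Notation P p := (res_mod F p).
Local Notation d := (koszul (@sym_var R V)).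
Local Notation X := (@sym_var R V).
Implicit Types (y : seq I -> S).

Let aug : {additive P 0 -> A} := res_aug F.
Let gr p := res_grading F p.
Let comp p q := component (gr p) q.

Lemma res_diff_diff p (x : P p.+2) : res_diff F p (res_diff F p.+1 x) = 0.
Proof. by apply/res_exact; exists x. Qed.

Lemma res_aug_diff (x : P 1) : res_aug F (res_diff F 0 x) = 0.
Proof. by apply/res_exact0; exists x. Qed.

Lemma res_koszul_exact p : koszul_exact X (P p).
Proof.
by apply: koszul_exact_projective; [exact: koszul_exact_sym|exact: res_projective].
Qed.

Lemma res_aug_koszul (x : seq I -> P 0) t :
  res_aug F (d x t) = \sum_k to_quotient (X k) * res_aug F (x (k :: t)).
Proof. by rewrite raddf_sum; apply: eq_bigr => k _; rewrite res_augZ. Qed.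

Lemma to_quotient_koszul y t :
  to_quotient (d (y : seq I -> S^o) t) = \sum_k to_quotient (X k) * to_quotient (y (k :: t)) :> A.
Proof. by rewrite raddf_sum; apply: eq_bigr => k _; apply: to_quotientM. Qed.

Lemma component_koszul p q (x : seq I -> P p) t :
  comp q (d x t) = d (fun s => comp (q - 1) (x s)) t.
Proof.
rewrite /comp raddf_sum; apply: eq_bigr => k _.
by rewrite -(componentZ _ _ _ (sym_homog_var k)) subrK.
Qed.

(** A path in the double complex F (x) /\V from x in F_p (x) /\^j V down to
    A (x) /\^(p+j) V.  Its end is given by y, a lift to S of a tensor over A. *)
Fixpoint zigzag p (j : nat) : (seq I -> P p) -> (seq I -> S) -> Prop :=
  match p return (seq I -> P p) -> (seq I -> S) -> Prop with
  | 0 => fun x y => forall t, res_aug F (x t) = to_quotient (y t)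
  | p'.+1 => fun x y => exists x', [/\ alt_tensor j.+1 x',
      forall t, res_diff F p' (x t) = d x' t & zigzag j.+1 x' y]
  end.

(** The condition under which a zigzag can leave x; for j = 0 it says that the
    class of x in F_p / m F_p is a cycle. *)
Definition zigzag_start p j : (seq I -> P p) -> Prop :=
  match p return (seq I -> P p) -> Prop with
  | 0 => fun=> True
  | p'.+1 => fun x => exists2 x', alt_tensor j.+1 x' &
      forall t, res_diff F p' (x t) = d x' t
  end.

(** Given x' with the Koszul image equal to the differential of x, the
    differential of x' is a Koszul cycle, hence a Koszul boundary, and one can
    continue.  Replacing x' by a homogeneous component keeps the zigzag
    homogeneous. *)
Lemma zigzag_exists p j q (x : seq I -> P p) : alt_tensor j x ->
  zigzag_start j x -> (forall t, res_deg q (x t)) ->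
  exists2 y, zigzag j x y &
    forall t, quotient_homog (q - p%:Z) (to_quotient (y t)).
Proof.
elim: p j q x => [|p IH] j q x hx.
  move=> _ xq; have /boolp.choice[y yE] t := to_quotient_surj (res_aug F (x t)).
  by exists y => t; rewrite ?subr0 yE //; apply: res_aug_deg.
move=> [x0 hx0 x0E] xq.
pose x' t := comp (q - 1) (x0 t).
have hx' : alt_tensor j.+1 x' by apply: (alt_tensor_additive (comp (q - 1))).
have x'E t : res_diff F p (x t) = d x' t.
  rewrite -component_koszul -x0E /comp component_id //.
  exact: res_diff_deg.
have st : zigzag_start j.+1 x'.
  case: p {IH} => // p in x xq hx x0 hx0 x0E x' hx' x'E *.
  have [|t|u hu uE] := @res_koszul_exact p j (fun t => res_diff F p (x' t)).
  - exact: (alt_tensor_additive (res_diff F p)).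
  - by rewrite -koszul_linear -x'E res_diff_diff.
  - by exists u.
have [y zy yq] := IH j.+1 (q - 1) x' hx' st (fun t => componentP (gr p) (q - 1) (x0 t)).
exists y; first by exists x'.
by move=> t; have := yq t; rewrite -addrA -opprD -intS.
Qed.

Lemma zigzag_comb p j (f : S) (x1 x2 : seq I -> P p) y1 y2 :
  zigzag j x1 y1 -> zigzag j x2 y2 ->
  zigzag j (fun t => f *: x1 t + x2 t) (fun t => f * y1 t + y2 t).
Proof.
elim: p j x1 x2 => [|p IH] j x1 x2 /=.
  move=> z1 z2 t; rewrite raddfD res_augZ z1 z2.
  by rewrite to_quotientD to_quotientM.
move=> [x1' [[h1 h1'] e1 z1]] [x2' [[h2 h2'] e2 z2]].
exists (fun t => f *: x1' t + x2' t); split; last exact: IH.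
  split=> [s a b t|t tj]; first by rewrite h1 h2 scalerN opprD.
  by rewrite h1' // h2' // scaler0 addr0.
by move=> t; rewrite linearP e1 e2 koszulD koszulZ.
Qed.

Lemma zigzag_alt p j (x : seq I -> P p) y : alt_tensor j x -> zigzag j x y ->
  alt_tensor (p + j) (fun t => to_quotient (y t) : A).
Proof.
elim: p j x => [|p IH] j x hx /=.
  move=> z; rewrite (_ : (fun t => _) = fun t => res_aug F (x t)).
    exact: (alt_tensor_additive (res_aug F)).
  by apply: funext => t; rewrite z.
by move=> [x' [hx' _ /IH]]; rewrite addSnnS; apply.
Qed.

(** At the last step the augmentation of the Koszul image of x' is the
    augmentation of a differential. *)
Lemma zigzag_cycle p j (x : seq I -> P p) y : zigzag j x y -> (0 < p)%N ->
  forall t, to_quotient (d (y : seq I -> S^o) t) = 0 :> A.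
Proof.
elim: p j x => // p IH j x /= [x' [hx' e z]] _ t.
case: p => [|p] in IH x x' hx' e z *; last exact: (IH _ _ z).
rewrite to_quotient_koszul; under eq_bigr do rewrite -z.
by rewrite -res_aug_koszul -e res_aug_diff.
Qed.

(** Injectivity of the comparison, climbing from A back to F_p: a boundary at the
    end is lifted along F, and at each step exactness of F corrects x. *)
Lemma zigzag_boundary p j (x : seq I -> P p) y v :
  alt_tensor j x -> zigzag j x y -> alt_tensor (p + j).+1 v ->
  (forall t, to_quotient (y t) = to_quotient (d (v : seq I -> S^o) t) :> A) ->
  exists u z, [/\ alt_tensor j.+1 u, alt_tensor j z &
    forall t, x t = d u t + res_diff F p (z t)].
Proof.
elim: p j x => [|p IH] j x hx /=.
  move=> z hv yv.
  have [u hu uE] : exists2 u, alt_tensor j.+1 u &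
      forall t, res_aug F (u t) = to_quotient (v t).
    apply: (alt_tensor_lift (f := aug)); first exact: two_free_quotient.
      exact: (alt_tensor_additive (@to_quotient R V)).
    by move=> t; apply: res_aug_surj.
  have hk : alt_tensor j (fun t => x t - d u t).
    rewrite (_ : (fun t => _) = fun t => x t + (- 1) *: d u t).
      apply: alt_tensorD => //; have [h h0] := koszul_alt_tensor X hu.
      split=> [s a b t|t tj]; first by rewrite h scalerN.
      by rewrite h0 // scaler0.
    by apply: funext => t; rewrite scaleN1r.
  have [t|w hw wE] := alt_tensor_lift (f := res_diff F 0) (two_free_sym (M := P 0)) hk.
    have [|w ->] := (res_exact0 (x t - d u t)).1; last by exists w.
    rewrite raddfB z yv res_aug_koszul to_quotient_koszul.
    by under [X in _ - X]eq_bigr do rewrite uE; rewrite subrr.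
  by exists u, w; split=> // t; rewrite wE addrC subrK.
move=> [x' [hx' e z]]; rewrite addSnnS => hv yv.
have [u' [w' [hu' hw' x'E]]] := IH _ _ hx' z hv yv.
have hk : alt_tensor j (fun t => x t - d w' t).
  rewrite (_ : (fun t => _) = fun t => x t + (- 1) *: d w' t).
    apply: alt_tensorD => //; have [h h0] := koszul_alt_tensor X hw'.
    split=> [s a b t|t tj]; first by rewrite h scalerN.
    by rewrite h0 // scaler0.
  by apply: funext => t; rewrite scaleN1r.
have [t|w hw wE] := alt_tensor_lift (f := res_diff F p.+1) (two_free_sym (M := P p.+1)) hk.
  have [|w ->] := (res_exact (x t - d w' t)).1; last by exists w.
  rewrite linearB e koszul_linear.
  have -> : d x' t = d (fun s => d u' s + res_diff F p (w' s)) t by exact: eq_koszul.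
  rewrite koszulD koszul_koszul ?add0r ?subrr //; first exact: two_free_sym.
  exact: hu'.1.
by exists w', w; split=> // t; rewrite wE addrC subrK.
Qed.

(** The comparison is well defined: descending from F_p, exactness of the Koszul
    complex shows that a boundary stays a boundary. *)
Lemma boundary_zigzag p j (x : seq I -> P p) y u z :
  zigzag j x y -> alt_tensor j.+1 u -> alt_tensor j z ->
  (forall t, x t = d u t + res_diff F p (z t)) ->
  exists2 v, alt_tensor (p + j).+1 v &
    forall t, to_quotient (y t) = to_quotient (d (v : seq I -> S^o) t) :> A.
Proof.
elim: p j x u z => [|p IH] j x u z /=.
  move=> zz hu hz xE.
  have [v hv vE] : exists2 v, alt_tensor j.+1 v &
      forall t, to_quotient (v t) = res_aug F (u t).
    apply: (alt_tensor_lift (f := @to_quotient R V)); first exact: two_free_quotient.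
      exact: (alt_tensor_additive (res_aug F)).
    by move=> t; apply: to_quotient_surj.
  exists v => // t; rewrite -zz xE raddfD res_aug_diff addr0.
  by rewrite res_aug_koszul to_quotient_koszul; under [RHS]eq_bigr do rewrite vE.
move=> [x' [hx' e zz]] hu hz xE; rewrite addSnnS.
have hk : alt_tensor j.+1 (fun t => x' t - res_diff F p (u t)).
  rewrite (_ : (fun t => _) = fun t => x' t + res_diff F p (- u t)).
    apply: alt_tensorD => //.
    apply: (alt_tensor_additive (res_diff F p) (x := fun t => - u t)).
    case: hu => h h0; split=> [s a b t|t tj]; first by rewrite h.
    by rewrite h0 ?oppr0.
  by apply: funext => t; rewrite linearN.
have [t|u' hu' u'E] := res_koszul_exact hk.
  rewrite koszulB -e -koszul_linear -linearB.
  by rewrite xE addrAC subrr add0r res_diff_diff.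
apply: (IH j.+1 x' u' u zz hu' hu) => t.
by rewrite -u'E subrK.
Qed.

(** The vanishing of a coefficient of degree at most 1, which makes sense in A
    by [to_quotient_eq]. *)
Definition low_coeff0 (m : 'X_{1..n}) (a : A) :=
  exists2 f, to_quotient f = a & sym_coeff m f = 0.

Lemma low_coeff0D m a b : low_coeff0 m a -> low_coeff0 m b -> low_coeff0 m (a + b).
Proof.
move=> [f <- f0] [g <- g0]; exists (f + g); first exact: to_quotientD.
by rewrite sym_coeffD f0 g0 addr0.
Qed.

Lemma low_coeff0P m f : (mdeg m < 2)%N ->
  low_coeff0 m (to_quotient f) <-> sym_coeff m f = 0.
Proof.
move=> m2; split; last by exists f.
by move=> [g /to_quotient_eq /(_ m m2) <-].
Qed.

Lemma quotient_homog_low_coeff0 q m (a : A) :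
  quotient_homog q a -> q != (mdeg m)%:Z -> low_coeff0 m a.
Proof.
case: q => [k [f hf ->] km|k /= -> _].
  exists f => //; apply: (dhomog_nemf_coeff hf).
  by apply: contraNneq km => <-.
by exists 0; [exact: raddf0|exact: mcoeff0].
Qed.

Lemma quotient_homog_sum q (s : seq (int * P 0)) (a : A) :
  quotient_homog q a -> (forall b, b \in s -> b.1 != q /\ res_deg b.1 b.2) ->
  a = \sum_(b <- s) res_aug F b.2 -> a = 0.
Proof.
move=> aq hs aE; have [f fE] := to_quotient_surj a.
rewrite -fE -[RHS](@to_quotient0 R V); apply/to_quotient_eq => m m2.
rewrite (_ : sym_coeff m 0 = 0); last exact: mcoeff0.
apply/(low_coeff0P _ m2); rewrite fE.
have [qm|] := eqVneq q (mdeg m)%:Z; last exact: quotient_homog_low_coeff0.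
rewrite aE big_seq; apply: big_ind; [|exact: low_coeff0D|].
  by exists 0; [exact: raddf0|exact: mcoeff0].
move=> b /hs[bq Db]; apply: (quotient_homog_low_coeff0 (res_aug_deg Db)).
by rewrite -qm.
Qed.

(** The components of x of degrees other than q have augmentations of these
    degrees; their sum has degree q as well, and so is 0. *)
Lemma res_aug_component q (x : P 0) : quotient_homog q (res_aug F x) ->
  res_aug F (comp q x) = res_aug F x.
Proof.
move=> xq; apply/esym/eqP; rewrite -subr_eq0 -raddfB; apply/eqP.
have [s [hs sE]] := component_off (gr 0) q x.
apply: (quotient_homog_sum (q := q) (s := s)) => //; last by rewrite /comp sE raddf_sum.
have : quotient_homog q (res_aug F (comp q x)) by apply: res_aug_deg; apply: componentP.
rewrite raddfB; case: q xq {hs sE} => [k [f hf ->] [g hg ->]|k /= -> ->].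
  by exists (f - g); [exact: rpredB|rewrite raddfB].
exact: subrr.
Qed.

Definition zigzag_closed p : (seq I -> P p) -> Prop :=
  match p return (seq I -> P p) -> Prop with
  | 0 => fun x => forall t, res_aug F (d x t) = 0
  | p'.+1 => fun x => forall t, res_diff F p' (d x t) = 0
  end.

(** Surjectivity of the comparison: starting from A, each Koszul differential is
    killed by the differential of F and is lifted along F.  Homogeneous
    components of lifts are still lifts. *)
Lemma zigzag_surj p j q y : alt_tensor (p + j) y ->
  (forall t, to_quotient (d (y : seq I -> S^o) t) = 0 :> A) ->
  (forall t, quotient_homog (q - p%:Z) (to_quotient (y t))) ->
  exists x : seq I -> P p, [/\ alt_tensor j x, zigzag j x y, zigzag_closed x &
    forall t, res_deg q (x t)].
Proof.
elim: p j q y => [|p IH] j q y hy dy yq.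
  have [t|z hz zE] := alt_tensor_lift (f := aug) (@two_free_quotient R V)
      (alt_tensor_additive (@to_quotient R V) hy); first exact: res_aug_surj.
  exists (fun t => comp q (z t)); split.
  - exact: (alt_tensor_additive (comp q)).
  - by move=> t; rewrite res_aug_component zE //; have := yq t; rewrite subr0.
  - move=> t; rewrite -[RHS](dy t) res_aug_koszul to_quotient_koszul.
    apply: eq_bigr => k _; rewrite res_aug_component zE //.
    by have := yq (k :: t); rewrite subr0.
  - by move=> t; apply: componentP.
have [|t|x' [hx' zx' cx' dx']] := IH j.+1 (q - 1) y _ dy; first by rewrite addnS.
  by have := yq t; rewrite intS opprD addrA.
have [t|z hz zE] := alt_tensor_lift (f := res_diff F p) (two_free_sym (M := P p))
    (koszul_alt_tensor X hx').
  suff [w wE] : exists w, d x' t = res_diff F p w by exists w.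
  case: p {IH yq} => [|p] in x' hx' cx' dx' hy zx' *.
    by apply/res_exact0; apply: cx'.
  by apply/res_exact; apply: cx'.
have xE t : res_diff F p (comp q (z t)) = d x' t.
  rewrite /comp -(component_map _ (gr p) (@res_diff_deg _ _ F p)) /= zE.
  apply: component_id; apply: big_ind; first exact: grading0.
    exact: gradingD.
  move=> k _; rewrite -(subrK 1 q).
  exact: (gradingZ (gr p) (sym_homog_var k) (dx' _)).
exists (fun t => comp q (z t)); split.
- exact: (alt_tensor_additive (comp q)).
- by exists x'.
- move=> t; rewrite koszul_linear.
  have -> : d (fun s => res_diff F p (comp q (z s))) t = d (d x') t by exact: eq_koszul.
  by apply: koszul_koszul; [exact: two_free_sym|exact: hx'.1].
- by move=> t; apply: componentP.
Qed.

End Zigzag.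

(** * Semilinear lifts *)

Section Action.
Variables (R : realType) (V : vectType R[i]).
Local Notation n := (\dim {:V}).
Local Notation C := R[i].
Local Notation I := 'I_n.
Local Notation S := (Sym V).
Local Notation A := (quadric_quotient V).
Local Notation X := (@sym_var R V).
Local Notation b := (vbasis {:V}).
Implicit Types (f h : S) (g : 'End(V)).

Definition sym_mx g (a k : I) : S := sym_scalar V (end_mx g a k).

Lemma sym_act_var g k : sym_act g (X k) = \sum_a sym_mx g a k * X a.
Proof.
rewrite /sym_act /sym_var comp_mpolyXU (nth_map k) ?size_enum_ord // nth_ord_enum.
apply: eq_bigr => a _; exact/esym/mul_mpolyC.
Qed.

Lemma sym_actD g f h : sym_act g (f + h) = sym_act g f + sym_act g h.
Proof. exact: comp_mpolyD. Qed.

Lemma sym_actM g f h : sym_act g (f * h) = sym_act g f * sym_act g h.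
Proof. exact: rmorphM. Qed.

Lemma sym_act_scalar g c : sym_act g (sym_scalar V c) = sym_scalar V c.
Proof. exact: comp_mpolyC. Qed.

Lemma sym_coeff0M f h :
  sym_coeff 0%MM (f * h) = sym_coeff 0%MM f * sym_coeff 0%MM h.
Proof. exact: (rmorphM (mcoeff 0%MM)). Qed.

Lemma sym_coeff1_deriv a f :
  sym_coeff U_(a)%MM f = ((f : {mpoly C[n]})^`M(a))@_0%MM.
Proof. by rewrite mcoeff_deriv add0m mnm0E mulr1n. Qed.

Lemma sym_coeff1M a f h : sym_coeff U_(a)%MM (f * h) =
  sym_coeff U_(a)%MM f * sym_coeff 0%MM h + sym_coeff 0%MM f * sym_coeff U_(a)%MM h.
Proof.
rewrite !sym_coeff1_deriv mderivM mcoeffD.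
by rewrite !(rmorphM (mcoeff 0%MM)).
Qed.

Lemma sym_coeff_scalar m c f : sym_coeff m (sym_scalar V c * f) = c * sym_coeff m f.
Proof. exact: mcoeffCM. Qed.

Lemma sym_coeff1_var a k : sym_coeff U_(a)%MM (X k) = (k == a)%:R.
Proof. exact: mcoeffXU. Qed.

Lemma sym_coeff0_var k : sym_coeff 0%MM (X k) = 0.
Proof. by rewrite /sym_coeff /sym_var mcoeffX mnm1_eq0. Qed.

Definition act_linearizes g f := sym_coeff 0%MM (sym_act g f) = sym_coeff 0%MM f /\
  forall a, sym_coeff U_(a)%MM (sym_act g f) = \sum_k end_mx g a k * sym_coeff U_(k)%MM f.

(** S(g) preserves the augmentation ideal m and acts on m / m^2 = V as g; it is
    enough to check this on generators, by the product rule for coefficients. *)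
Lemma sym_act_low g f : act_linearizes g f.
Proof.
have QD f1 f2 : act_linearizes g f1 -> act_linearizes g f2 -> act_linearizes g (f1 + f2).
  rewrite /act_linearizes sym_actD; move: (sym_act g f1) (sym_act g f2) => u1 u2.
  move=> [h1 k1] [h2 k2]; split=> [|a]; first by rewrite !(sym_coeffD _ _ u2) h1 h2 -sym_coeffD.
  rewrite sym_coeffD k1 k2 -big_split.
  by apply: eq_bigr => k _; rewrite sym_coeffD mulrDr.
have QM f1 f2 : act_linearizes g f1 -> act_linearizes g f2 -> act_linearizes g (f1 * f2).
  rewrite /act_linearizes sym_actM; move: (sym_act g f1) (sym_act g f2) => u1 u2.
  move=> [h1 k1] [h2 k2]; split=> [|a].
    by rewrite (sym_coeff0M u1) (sym_coeff0M f1) h1 h2.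
  rewrite (sym_coeff1M a u1) h1 h2 k1 k2 mulr_suml mulr_sumr -big_split.
  by apply: eq_bigr => k _; rewrite (sym_coeff1M k f1) /=; ring.
have QC c : act_linearizes g (sym_scalar V c).
  rewrite /act_linearizes sym_act_scalar; split=> // a.
  have E k : sym_coeff U_(k)%MM (sym_scalar V c) = 0.
    by rewrite /sym_coeff mcoeffC mnm1_eq0 mulr0.
  by rewrite E big1 // => k _; rewrite E mulr0.
have QX k : act_linearizes g (X k).
  split=> [|a]; rewrite sym_act_var raddf_sum.
    rewrite sym_coeff0_var big1 // => a _; rewrite /= sym_coeff0M sym_coeff0_var.
    exact: mulr0.
  rewrite (bigD1 a) //= [RHS](bigD1 k) //= !big1 ?addr0.
  - by rewrite sym_coeff_scalar !sym_coeff1_var !eqxx.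
  - by move=> l lk; rewrite sym_coeff1_var eq_sym (negbTE lk) mulr0.
  - by move=> l la; rewrite sym_coeff_scalar sym_coeff1_var (negbTE la) mulr0.
elim/mpolyind: f => [|c m p _ _ IH]; first by have := QC 0; rewrite /sym_scalar mpolyC0.
apply: (QD (c *: 'X_[m] : {mpoly C[n]}) p) => //; rewrite -mul_mpolyC.
apply: (QM (sym_scalar V c) ('X_[m] : {mpoly C[n]})); first exact: QC.
rewrite mpolyXE_id; apply: (big_ind (fun f : S => act_linearizes g f)) => //.
  by have := QC 1.
move=> k _; elim: (m k) => [|e IHe]; first by have := QC 1.
by rewrite exprS; apply: (QM (X k)).
Qed.

End Action.

Section Lift.
Variables (R : realType) (V : vectType R[i]) (F : graded_resolution V).
Local Notation n := (\dim {:V}).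
Local Notation C := R[i].
Local Notation I := 'I_n.
Local Notation S := (Sym V).
Local Notation A := (quadric_quotient V).
Local Notation P p := (res_mod F p).
Local Notation d := (koszul (@sym_var R V)).
Local Notation X := (@sym_var R V).
Implicit Types (y : seq I -> S).

Variables (g : 'End(V)) (G : forall p, P p -> P p).
Hypothesis gG : is_lift g G.

Fact lift_additive p : additive (@G p).
Proof.
have GD := liftD gG (p := p).
have G0 : @G p 0 = 0 by apply: (addrI (@G p 0)); rewrite -GD !addr0.
have GN x : @G p (- x) = - @G p x.
  by apply: (addrI (@G p x)); rewrite -GD !subrr.
by move=> x y; rewrite GD GN.
Qed.

Definition lift_map p : {additive P p -> P p} :=
  HB.pack (@G p) (GRing.isAdditive.Build _ _ _ (@lift_additive p)).

(** The tensor product of G on F_p and g on /\V. *)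
Definition tensor_lift p (x : seq I -> P p) : seq I -> P p :=
  tensor_act (sym_mx g) (fun s => @G p (x s)).

Lemma tensor_lift_alt p j (x : seq I -> P p) :
  alt_tensor j x -> alt_tensor j (tensor_lift x).
Proof.
by move=> hx; apply: tensor_act_alt_tensor; apply: (alt_tensor_additive (lift_map p)).
Qed.

Lemma tensor_lift_koszul p (x : seq I -> P p) t :
  tensor_act (sym_mx g) (fun s => @G p (d x s)) t = d (tensor_lift x) t.
Proof.
have E s : @G p (d x s) = \sum_l \sum_k (sym_mx g k l * X k) *: @G p (x (l :: s)).
  rewrite [LHS](raddf_sum (lift_map p)); apply: eq_bigr => l _ /=.
  by rewrite (liftZ gG) sym_act_var scaler_suml.
transitivity (tensor_act (sym_mx g)
    (fun s => \sum_l \sum_k (sym_mx g k l * X k) *: @G p (x (l :: s))) t).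
  by apply: eq_tensor_act => s _; apply: E.
rewrite tensor_act_sum; under eq_bigr do rewrite tensor_act_sum.
rewrite exchange_big; apply: eq_bigr => k _ /=; rewrite scaler_sumr.
by apply: eq_bigr => l _; rewrite tensor_actZ scalerA mulrC.
Qed.

(** Both differentials of the double complex commute with G (x) g. *)
Lemma zigzag_lift p j (x : seq I -> P p) y : zigzag j x y ->
  zigzag j (tensor_lift x)
    (tensor_act (M := S^o) (sym_mx g) (fun s => sym_act g (y s))).
Proof.
elim: p j x => [|p IH] j x /=.
  move=> z t; pose h a k : A := to_quotient (sym_mx g a k).
  transitivity (tensor_act (M := A^o) h (fun r => res_aug F (@G 0%N (x r))) t).
    apply: (tensor_act_map (N := A^o) (f := res_aug F)).
    - exact: raddfD.
    - exact: raddf0.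
    - by move=> a k u; rewrite res_augZ.
  transitivity (tensor_act (M := A^o) h (fun r => to_quotient (sym_act g (y r)) : A^o) t).
    by apply: (@eq_tensor_act n A A^o) => r _; apply: (lift_aug gG).
  symmetry; apply: (@tensor_act_map n S A S^o A^o (@to_quotient R V)).
  - exact: to_quotientD.
  - exact: raddf0.
  - by move=> a k u; apply: to_quotientM.
move=> [x' [hx' e z]]; exists (tensor_lift x'); split.
- exact: tensor_lift_alt.
- move=> t; rewrite -tensor_lift_koszul.
  rewrite (tensor_act_map (h := sym_mx g) _ t (raddfD _) (raddf0 _)) => [|a k u]; last exact: linearZ.
  by apply: eq_tensor_act => s _; rewrite -e (lift_diff gG).
- exact: IH.
Qed.

End Lift.

(** * The Tor groups *)

Section TorOfQuotient.
Variables (R : realType) (V : vectType R[i]) (F : graded_resolution V).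
Local Notation n := (\dim {:V}).
Local Notation C := R[i].
Local Notation I := 'I_n.
Local Notation S := (Sym V).
Local Notation A := (quadric_quotient V).
Local Notation P p := (res_mod F p).
Local Notation d := (koszul (@sym_var R V)).
Local Notation X := (@sym_var R V).
Local Notation scalar_tensor x := (@scalar_tensor n _ x).
Implicit Types (y : seq I -> S).

(** m is generated by the variables, so m P is the image of the first Koszul
    differential. *)
Lemma in_mPE p (x : P p) :
  in_mP x <-> exists v : I -> P p, x = \sum_k X k *: v k.
Proof.
split=> [[s [hs ->]]|[v ->]].
  have sumE (r : seq (S * P p)) : (forall am, am \in r -> sym_aug am.1 = 0) ->
      exists v : I -> P p, \sum_(am <- r) am.1 *: am.2 = \sum_k X k *: v k.
    elim: r => [|am r IH] hr.
      by exists (fun=> 0); rewrite big_nil big1 // => k _; rewrite scaler0.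
    have [|v vE] := IH; first by move=> a ar; apply: hr; rewrite inE ar orbT.
    have [q qE] := @augmentation_sum n C am.1 (hr am (mem_head _ _)).
    exists (fun k => (q k : S) *: am.2 + v k).
    rewrite big_cons vE; under [RHS]eq_bigr do rewrite scalerDr.
    rewrite big_split /=; congr (_ + _).
    under eq_bigr do rewrite scalerA.
    rewrite -scaler_suml; congr (_ *: _); exact: qE.
  exact: sumE.
exists [seq (X k, v k) | k <- enum I]; split.
  by move=> _ /mapP[k _ ->]; apply: sym_coeff0_var.
by rewrite big_map big_enum.
Qed.

Lemma zigzag_start_scalar p (x : P p) : res_cycle x -> zigzag_start 0 (scalar_tensor x).
Proof.
case: p x => // p x /= /in_mPE [v vE]; exists (vector_tensor v).
  exact: vector_tensor_alt.
case=> [|a t] /=; first by rewrite vE.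
by rewrite linear0 /koszul big1 // => k _; rewrite scaler0.
Qed.

Lemma zigzag_res_cycle p (x : P p) y : zigzag 0 (scalar_tensor x) y -> res_cycle x.
Proof.
case: p x => // p x [x' [_ e _]]; apply/in_mPE.
exists (fun k => x' [:: k]); exact: (e [::]).
Qed.

Lemma tor_zigzag p q (x : P p) : tor_cycle q x ->
  exists2 y, zigzag 0 (scalar_tensor x) y &
    forall t, quotient_homog (q - p%:Z) (to_quotient (y t)).
Proof.
move=> [xq /zigzag_start_scalar xs]; apply: zigzag_exists => //.
  exact: scalar_tensor_alt.
by case=> [|a t] //=; apply: grading0; apply: res_grading.
Qed.

(** The component in V (x) T(V) of the end of a zigzag. *)
Definition linear_part y (s : seq I) : C :=
  if s is a :: t then sym_coeff U_(a)%MM (y t) else 0.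

Lemma alt_low_coeff p y m : (mdeg m < 2)%N ->
  alt_tensor p (fun t => to_quotient (y t) : A) ->
  alt_tensor p (fun t => sym_coeff m (y t)).
Proof.
move=> m2 [hy y0]; split=> [s a b t|t tp].
  rewrite -sym_coeffN; apply: (to_quotient_eq _ _).1 m2.
  by rewrite to_quotientN; apply: hy.
rewrite (_ : 0 = sym_coeff m 0); last exact/esym/mcoeff0.
by apply: (to_quotient_eq _ _).1 m2; rewrite y0 //; exact/esym/(@to_quotient0 R V).
Qed.

Lemma linear_part_tail p (x : P p) y : zigzag 0 (scalar_tensor x) y ->
  tail_alternating (linear_part y).
Proof.
move=> z a; have := zigzag_alt (@scalar_tensor_alt n _ x) z.
by move=> /(alt_low_coeff (m := U_(a)%MM)); rewrite mdeg1 => /(_ isT) [].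
Qed.

Lemma linear_part_size p (x : P p) y s : zigzag 0 (scalar_tensor x) y ->
  size s != p.+1 -> linear_part y s = 0.
Proof.
case: s => // a t z tp; have := zigzag_alt (@scalar_tensor_alt n _ x) z.
move=> /(alt_low_coeff (m := U_(a)%MM)); rewrite mdeg1 => /(_ isT) [_ /=]; apply.
by rewrite addn0.
Qed.

(** The injectivity of /\^p V -> V (x) /\^(p-1) V: the end of a zigzag is a Koszul
    cycle, and its constant terms are the linear coefficients of its Koszul
    differential. *)
Lemma const_part0 p (x : P p) y t : (0 < p)%N -> zigzag 0 (scalar_tensor x) y ->
  sym_coeff 0%MM (y t) = 0.
Proof.
move=> p0 z; have [tp|tp] := eqVneq (size t) (p + 0)%N; last first.
  have := zigzag_alt (@scalar_tensor_alt n _ x) z.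
  by move=> /(alt_low_coeff (m := 0%MM)); rewrite mdeg0 => /(_ isT) [_ ->].
case: t tp => [|a t] tp; first by move: p0; rewrite -[p]addn0 -tp.
rewrite -sym_coeff1_koszul.
rewrite (_ : 0 = sym_coeff U_(a)%MM 0); last exact/esym/mcoeff0.
apply: (to_quotient_eq _ _).1; last by rewrite mdeg1.
by rewrite (zigzag_cycle z) //; exact/esym/(@to_quotient0 R V).
Qed.

(** Constants v with the values of the linear part form an element of
    /\^(p+1) V whose Koszul differential is the end of the zigzag. *)
Lemma zigzag_tor_boundary p (x : P p) y : zigzag 0 (scalar_tensor x) y ->
  (forall t, sym_coeff 0%MM (y t) = 0) -> alternating (linear_part y) ->
  exists z, in_mP (x - res_diff F p z).
Proof.
move=> z y0 hy.
pose v s := sym_scalar V (linear_part y s).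
have hv : alt_tensor (p + 0).+1 v.
  split=> [s a b t|t tp]; first by rewrite /v hy; exact: raddfN.
  rewrite addn0 in tp; rewrite /v (linear_part_size z tp); exact: raddf0.
have [|u [w [hu hw E]]] := zigzag_boundary (@scalar_tensor_alt n _ x) z hv.
  move=> t; apply/to_quotient_eq => m /mdeg_lt2[->|[a ->]].
    by rewrite y0 sym_coeff0_koszul.
  by rewrite sym_coeff1_koszul /v /sym_coeff /sym_scalar mcoeffC eqxx mulr1.
exists (w [::]); apply/in_mPE; exists (fun k => u [:: k]).
by have /= -> := E [::]; rewrite addrK.
Qed.

Lemma boundary_linear_part p (x : P p) y z : zigzag 0 (scalar_tensor x) y ->
  in_mP (x - res_diff F p z) ->
  alternating (linear_part y) /\ forall t, sym_coeff 0%MM (y t) = 0.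
Proof.
move=> zy /in_mPE [u uE].
have [t|v hv vE] := boundary_zigzag zy (@vector_tensor_alt n _ u) (@scalar_tensor_alt n _ z).
  case: t => [|a t] /=; first by rewrite -[d _ _]uE subrK.
  rewrite linear0 addr0 /koszul big1 // => k _; exact: scaler0.
have yE m t : (mdeg m < 2)%N -> sym_coeff m (y t) = sym_coeff m (d (v : seq I -> S^o) t).
  exact: (to_quotient_eq _ _).1 (vE t) m.
split=> [|t]; last by rewrite yE ?mdeg0 // sym_coeff0_koszul.
have E s : linear_part y s = if s is [::] then 0 else sym_coeff 0%MM (v s).
  by case: s => //= a t; rewrite yE ?mdeg1 // sym_coeff1_koszul.
have [hv' _] := hv; move=> s a b t; rewrite !E.
have N : sym_coeff 0%MM (v (s ++ a :: b :: t)) = - sym_coeff 0%MM (v (s ++ b :: a :: t)).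
  by rewrite hv'; exact: raddfN.
by case: s N.
Qed.

Lemma zigzag_scalar_comb p c (x1 x2 : P p) y1 y2 :
  zigzag 0 (scalar_tensor x1) y1 -> zigzag 0 (scalar_tensor x2) y2 ->
  zigzag 0 (scalar_tensor (sym_scalar V c *: x1 + x2))
    (fun t => sym_scalar V c * y1 t + y2 t).
Proof.
move=> z1 z2; have := zigzag_comb (sym_scalar V c) z1 z2.
congr (zigzag 0 _ _); apply: funext => -[|a t] //=.
by rewrite scaler0 addr0.
Qed.

Lemma linear_part_lift (g : 'End(V)) y s :
  linear_part (tensor_act (M := S^o) (sym_mx g) (fun r => sym_act g (y r))) s =
  tensor_act (M := C^o) (end_mx g) (linear_part y) s.
Proof.
case: s => [|a t] //=.
rewrite (tensor_act_map (M := S^o) (N := C^o) (h := end_mx g) _ t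
  (raddfD (sym_coeff U_(a)%MM)) (raddf0 (sym_coeff U_(a)%MM))); last first.
  by move=> k l u; apply: sym_coeff_scalar.
transitivity (tensor_act (M := C^o) (end_mx g)
  (fun r => \sum_k end_mx g a k * sym_coeff U_(k)%MM (y r) : C^o) t).
  by apply: eq_tensor_act => r _; apply: (sym_act_low g (y r)).2.
rewrite (@tensor_act_sum n C C^o); apply: eq_bigr => k _.
exact: (@tensor_actZ n C C^o).
Qed.

Lemma const_part_lift (g : 'End(V)) f :
  sym_coeff 0%MM (sym_act g f) = sym_coeff 0%MM f.
Proof. exact: (sym_act_low g f).1. Qed.

(** The end of the zigzag has degree q - p in A.  For p >= 1 its constant part
    vanishes anyway, and its linear part does since q - p is not 1.  For
    p = 0 and q = 1 the linear part is in V, which is the Koszul boundary of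
    /\^1 V. *)
Lemma tor_zero_off_diagonal p q :
  ~ ((1 <= p)%N /\ q = Posz p.+1) -> ~ (p = 0%N /\ q = Posz 0) -> tor_zero F p q.
Proof.
move=> h1 h0 x xc; split; first exact: xc.1.
have [y z yq] := tor_zigzag xc.
have low t m : (mdeg m < 2)%N -> q - p%:Z != (mdeg m)%:Z -> sym_coeff m (y t) = 0.
  move=> m2 qm; apply/(low_coeff0P _ m2).
  by apply: quotient_homog_low_coeff0 qm; apply: yq.
have [p0|p0] := posnP p.
  apply: (zigzag_tor_boundary z).
    move=> t; apply: low; rewrite mdeg0 // p0 subr0; apply/eqP => q0.
    by apply: h0.
  move=> s a b t; rewrite !(linear_part_size z) ?oppr0 //;
    by rewrite size_cat /= p0 !addnS.
have lin0 s : linear_part y s = 0.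
  case: s => //= a t; apply: low; rewrite mdeg1 //; apply/eqP => q1.
  by apply: h1; split=> //; rewrite -[LHS](subrK p%:Z) q1.
apply: (zigzag_tor_boundary z); first by move=> t; apply: (const_part0 _ p0 z).
by move=> s a b t; rewrite !lin0 oppr0.
Qed.

Lemma tor_iso_trivial : tor_iso F 0 0 (GL_trivial V).
Proof.
have /boolp.choice[f fE] (x : P 0) := to_quotient_surj (res_aug F x).
have fu x h : to_quotient h = res_aug F x -> sym_coeff 0%MM (f x) = sym_coeff 0%MM h.
  by move=> hE; apply: (to_quotient_eq _ _).1; rewrite ?mdeg0 // fE hE.
exists (fun x => sym_coeff 0%MM (f x) : C^o); split.
- move=> c x1 x2 _ _; rewrite (fu _ (sym_scalar V c * f x1 + f x2)).
    by rewrite sym_coeffD sym_coeff_scalar.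
  by rewrite [RHS]raddfD res_augZ -!fE to_quotientD to_quotientM.
- move=> w; have [x xE] := res_aug_surj F (to_quotient (sym_scalar V w)).
  have xq : quotient_homog 0 (res_aug F x).
    exists (sym_scalar V w) => //; rewrite /sym_homog /sym_scalar -[_%:MP]mulr1 mul_mpolyC.
    by apply: dhomogZ; apply: dhomog1.
  exists (component (res_grading F 0) 0 x); first by split=> //; apply: componentP.
  rewrite (fu _ (sym_scalar V w)); last by rewrite res_aug_component.
  by rewrite /sym_coeff mcoeffC eqxx mulr1.
- move=> x [xq _]; split=> [fx0|[_ [z /in_mPE [v vE]]]].
    split=> //; have [|z xE] := (res_exact0 x).1; last first.
      by exists z; rewrite xE subrr; exists [::]; rewrite big_nil.
    rewrite -fE -(@to_quotient0 R V); apply/to_quotient_eq => m m2; rewrite sym_coeff0.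
    have [m0|m1] := mdeg_lt2 m2; first by rewrite m0.
    apply/(low_coeff0P _ m2); rewrite fE.
    apply: (quotient_homog_low_coeff0 (res_aug_deg xq)).
    by case: m1 => a ->; rewrite mdeg1.
  rewrite (fu _ (d (fun s => if s is [:: k] then f (v k) else 0 : S^o) [::])).
    exact: sym_coeff0_koszul.
  rewrite to_quotient_koszul -[x](subrK (res_diff F 0 z)) vE raddfD res_aug_diff addr0.
  by rewrite raddf_sum; apply: eq_bigr => k _; rewrite res_augZ fE.
- move=> g G gG glift x _; rewrite id_lfunE (fu _ (sym_act g (f x))).
    exact: const_part_lift.
  by rewrite (lift_aug glift (f := f x)) // fE.
Qed.

Section Hook.
Variables (p' : nat).
Local Notation p := p'.+1.
Local Notation T := {ffun p'.+2.-tuple I -> C^o}.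
Variable H : {vspace T}.
Hypothesis HE : forall u, u \in H <-> hook_tensor u.

Definition zigzag_value y : hook_module HE :=
  vsproj H (pack p'.+2 (symmetrize2 (linear_part y))).

Lemma zigzag_valueE (x : P p) y : zigzag 0 (scalar_tensor x) y ->
  vsval (zigzag_value y) = pack p'.+2 (symmetrize2 (linear_part y)).
Proof.
move=> z; apply: vsprojK; apply/HE; exists (linear_part y) => //.
exact: linear_part_tail z.
Qed.

Lemma zigzag_value_comb c y1 y2 :
  zigzag_value (fun t => sym_scalar V c * y1 t + y2 t) =
  c *: zigzag_value y1 + zigzag_value y2.
Proof.
rewrite /zigzag_value -linearP -packP; congr (vsproj H _).
apply: eq_pack => -[|a [|b t]] _ //=; rewrite ?mulr0 ?addr0 //.
by rewrite !sym_coeffD !sym_coeff_scalar mulrDr addrACA.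
Qed.

(** The kernel of symmetrization consists of the totally alternating tensors,
    which are the Koszul boundaries. *)
Lemma zigzag_value_boundary (x : P p) y : zigzag 0 (scalar_tensor x) y ->
  (zigzag_value y = 0 <-> exists z, in_mP (x - res_diff F p z)).
Proof.
move=> zy; split=> [y0|[z /(boundary_linear_part zy) [hy _]]]; last first.
  apply: val_inj; rewrite /= (zigzag_valueE zy); apply/ffunP => s.
  by rewrite !ffunE symmetrize2_eq0.
apply: (zigzag_tor_boundary zy); first by move=> t; apply: (const_part0 _ _ zy).
have ps : pack p'.+2 (symmetrize2 (linear_part y)) = 0.
  by rewrite -(zigzag_valueE zy) y0.
case=> [|c s] a b t; last exact: (linear_part_tail zy).
have [tp|tp] := eqVneq (size t) p'; last first.
  by rewrite !(linear_part_size zy) ?oppr0 //= !eqSS.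
have ts : size (a :: b :: t) == p'.+2 by rewrite /= tp.
have /ffunP /(_ (Tuple ts)) := ps; rewrite !ffunE /= => /eqP.
by rewrite addr_eq0 => /eqP.
Qed.

Lemma zigzag_value_unique (x : P p) y1 y2 :
  zigzag 0 (scalar_tensor x) y1 -> zigzag 0 (scalar_tensor x) y2 ->
  zigzag_value y1 = zigzag_value y2.
Proof.
move=> z1 z2; have z := zigzag_scalar_comb (-1) z1 z2.
have : zigzag_value (fun t => sym_scalar V (-1) * y1 t + y2 t) = 0.
  apply/(zigzag_value_boundary z); exists 0; rewrite linear0 subr0.
  have -> : sym_scalar V (-1) = -1 :> S by rewrite /sym_scalar mpolyCN.
  rewrite scaleN1r addNr; by exists [::]; rewrite big_nil.
by rewrite zigzag_value_comb scaleN1r addrC => /eqP; rewrite subr_eq0 => /eqP.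
Qed.

(** The isomorphism sends a cycle to the symmetrized linear part of the end of
    any zigzag that starts from it. *)
Theorem tor_iso_hook : tor_iso F p (Posz p.+1) (hook_module HE).
Proof.
have /boolp.choice[phi phiE] (x : P p) : exists m : hook_module HE,
    tor_cycle (Posz p.+1) x -> exists2 y, zigzag 0 (scalar_tensor x) y & zigzag_value y = m.
  have [xc|nxc] := pselect (tor_cycle (Posz p.+1) x); last by exists 0.
  by have [y z _] := tor_zigzag xc; exists (zigzag_value y) => _; exists y.
have phi_eq x y : tor_cycle (Posz p.+1) x -> zigzag 0 (scalar_tensor x) y ->
    phi x = zigzag_value y.
  by move=> /phiE[y' z' <-] z; apply: zigzag_value_unique z' z.
have qp : Posz p.+1 - p%:Z = 1 by rewrite intS addrK.
exists phi; split.
- move=> c x1 x2 c1 c2; have [y1 z1 <-] := phiE _ c1; have [y2 z2 <-] := phiE _ c2.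
  have z := zigzag_scalar_comb c z1 z2.
  rewrite -zigzag_value_comb; apply: (phi_eq _ _ _ z); split; last exact: zigzag_res_cycle z.
  apply: (gradingD (res_grading F p)); last exact: c2.1.
  have := gradingZ (res_grading F p) (k := 0) (f := sym_scalar V c) _ c1.1.
  rewrite addr0; apply; rewrite /sym_homog /sym_scalar -[_%:MP]mulr1 mul_mpolyC.
  by apply: dhomogZ; apply: dhomog1.
- move=> m; have /HE [w hw mE] := subvsP m.
  pose y t : S := if size t == p then \sum_a sym_scalar V (w (a :: t)) * X a else 0.
  have hy : alt_tensor (p + 0) y.
    rewrite addn0; apply: (@alternating_trunc _ _ p
      (fun t => \sum_a sym_scalar V (w (a :: t)) * X a)).
    apply: alternating_sum => a s b c t; rewrite hw -mulNr; congr (_ * _).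
    exact: raddfN.
  have y1 a t : sym_coeff U_(a)%MM (y t) = if size t == p then w (a :: t) else 0.
    rewrite /y; case: ifP => _; last exact: mcoeff0.
    rewrite raddf_sum (bigD1 a) //= big1 ?addr0 => [|k ka].
      by rewrite sym_coeff_scalar sym_coeff1_var eqxx mulr1.
    by rewrite sym_coeff_scalar sym_coeff1_var (negbTE ka) mulr0.
  have y0 t : sym_coeff 0%MM (y t) = 0.
    rewrite /y; case: ifP => _; last exact: mcoeff0.
    rewrite raddf_sum big1 // => k _ /=.
    by rewrite sym_coeff_scalar sym_coeff0_var mulr0.
  have [t|t|x [hx zx _ dx]] := @zigzag_surj R V F p 0 (Posz p.+1) y hy.
  - rewrite -[RHS](@to_quotient0 R V); apply/to_quotient_eq => k.
    rewrite (_ : sym_coeff k 0 = 0); last exact: mcoeff0.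
    move=> /mdeg_lt2[->|[a ->]]; first exact: sym_coeff0_koszul.
    by rewrite sym_coeff1_koszul y0.
  - rewrite qp; exists (y t) => //; rewrite /y; case: ifP => _; last exact: rpred0.
    apply: (big_ind (fun f : S => sym_homog 1 f)); first exact: rpred0.
      by move=> f h; apply: rpredD.
    move=> a _; rewrite /sym_homog /sym_scalar mul_mpolyC; apply: dhomogZ.
    exact: sym_homog_var.
  have xE : x = scalar_tensor (x [::]).
    by apply: funext => -[|a t] //=; rewrite hx.2.
  rewrite xE in zx; exists (x [::]); first by split=> //; exact: zigzag_res_cycle zx.
  rewrite (phi_eq _ y) //; last by split=> //; exact: zigzag_res_cycle zx.
  apply: val_inj; rewrite /= (zigzag_valueE zx) mE; apply: eq_pack.
  by move=> [|a [|b t]] //= [tp]; rewrite !y1 /= tp eqxx.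
- move=> x xc; have [y zy <-] := phiE _ xc; rewrite (zigzag_value_boundary zy).
  by split=> [E|[_ E]] //; split=> //; exact: xc.1.
- move=> g G gG glift x xc; have [y zy <-] := phiE _ xc.
  have z := zigzag_lift glift zy.
  have xE : tensor_lift g G (scalar_tensor x) = scalar_tensor (G p x).
    apply: funext => -[|a t] //=.
    by rewrite (tensor_lift_alt glift (@scalar_tensor_alt n _ x)).2.
  rewrite xE in z; rewrite (phi_eq _ _ _ z); last first.
    split; last exact: zigzag_res_cycle z.
    by apply: (lift_deg glift); exact: xc.1.
  apply: val_inj; rewrite [LHS](zigzag_valueE z) [RHS](hook_actE HE) (zigzag_valueE zy) packed_act_pack.
  apply: eq_pack => s _; rewrite tensor_act_symmetrize2; congr symmetrize2.
  by apply: funext => r; apply: linear_part_lift.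
Qed.

End Hook.
End TorOfQuotient.

Theorem proposition4p2p1 (R : realType) (V : vectType (complex R))
    (F : graded_resolution V) :
  (forall p : nat, (1 <= p)%N ->
     exists2 M : GL_module V,
       is_pi (2%N :: nseq p.-1 1%N) M & tor_iso F p (Posz p.+1) M) /\
  tor_iso F 0%N (Posz 0) (GL_trivial V) /\
  (forall (p : nat) (q : int),
     ~ ((1 <= p)%N /\ q = Posz p.+1) -> ~ (p = 0%N /\ q = Posz 0) ->
     tor_zero F p q).
Proof.
split; last by split; [exact: tor_iso_trivial|exact: tor_zero_off_diagonal].
case=> // p' _.
have [H HE] := vspace_of_closed (@hook_tensor0 (\dim {:V}) R[i] p')
  (@hook_tensor_closed (\dim {:V}) R[i] p').
exists (hook_module HE); first exact: hook_module_is_pi.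
exact: tor_iso_hook.
Qed.
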